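(* Let $\nu>-1$ and for $n\in\mathbb{N}_0=\{0,1,2,\dots\}$ define $$\phi_n(x)=\frac{(-1)^n}{\sqrt{2^{4n-1}\,n!\,\Gamma(n+\nu+1)}}\;e^{x^2/2}\,\Delta_\nu^n e^{-x^2},\qquad x\in\mathbb{R}^+.$$ Then for every $n\in\mathbb{N}_0$ one has $\phi_n\in\operatorname{dom}(\mathcal{F}_\nu)$ and $\phi_n\in L^2(\mathbb{R}^+,x^{2\nu+1}\,dx)$; the family $\{\phi_n\}_{n\in\mathbb{N}_0}$ is an orthonormal basis for $L^2(\mathbb{R}^+,x^{2\nu+1}\,dx)$; and $\mathcal{F}_\nu\phi_n=(-1)^n\phi_n$ for every $n\in\mathbb{N}_0$.
   Context: $\mathbb{R}^+=(0,\infty)$. $\Delta_\nu=\frac{d^2}{dx^2}+\frac{2\nu+1}{x}\frac{d}{dx}$ is the Bessel differential operator. $J_\nu(x)=\sum_{n=0}^\infty \frac{(-1)^n}{n!\,\Gamma(n+\nu+1)}\left(\frac{x}{2}\right)^{2n+\nu}$ is the Bessel function of the first kind and $\varphi_\nu(x)=x^{-\nu}J_\nu(x)$. The Fourier--Bessel transform of order $\nu$ is $\mathcal{F}_\nu f(y)=\int_{\mathbb{R}^+}\varphi_\nu(xy)f(x)x^{2\nu+1}\,dx$ for $y\in\mathbb{R}^+$. Its domain is: $\operatorname{dom}(\mathcal{F}_\nu)=L^1(\mathbb{R}^+,x^{2\nu+1}\,dx)$ if $\nu>-\frac12$, and $\operatorname{dom}(\mathcal{F}_\nu)=L^1((0,R),x^{2\nu+1}\,dx)\cap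 L^1((R,\infty),x^{\nu+1/2}\,dx)$ if $-1<\nu<-\frac12$, where $R>1$ is a fixed large number (for $\nu=-\frac12$ the two descriptions coincide and $\mathcal{F}_\nu$ is the Fourier cosine transform). *)

(* Defs.v *)
From HB Require Import structures.
From mathcomp Require Import all_boot all_order all_algebra.
From mathcomp Require Import all_classical all_reals all_analysis.
From mathcomp Require Import complex.

Set Implicit Arguments.
Unset Strict Implicit.
Unset Printing Implicit Defensive.

Import Order.TTheory GRing.Theory Num.Theory.
Import numFieldNormedType.Exports.

Local Open Scope classical_set_scope.
Local Open Scope complex_scope.
Local Open Scope ring_scope.

(* Functions on R^+ are represented by functions on the whole of R; every
   notion below only depends on their values on `]0, +oo[. *)
Definition Rplus (R : realType) : set R := `]0, +oo[.
Arguments Rplus R : clear implicits.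

(* Euler's integral; only used for s > 0, where it converges. *)
Definition Gamma (R : realType) (s : R) : R :=
  \int[lebesgue_measure]_(t in Rplus R) (t `^ (s - 1) * expR (- t)).

Definition besselJ (R : realType) (nu x : R) : R :=
  limn (series (fun n : nat =>
    (-1) ^+ n / (n`!%:R * Gamma (n%:R + nu + 1)) * (x / 2) `^ (2 * n%:R + nu))).

Definition varphi (R : realType) (nu x : R) : R := x `^ (- nu) * besselJ nu x.

Definition bessel_op (R : realType) (nu : R) (f : R -> R) : R -> R :=
  fun x => derive1n 2 f x + (2 * nu + 1) / x * derive1 f x.

(* Componentwise Lebesgue integral of a complex-valued function. *)
Definition cintegral (R : realType) (D : set R) (f : R -> R[i]) : R[i] :=
  (\int[lebesgue_measure]_(x in D) complex.Re (f x)) +i*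
  (\int[lebesgue_measure]_(x in D) complex.Im (f x)).

Definition cmeasurable (R : realType) (D : set R) (f : R -> R[i]) : Prop :=
  measurable_fun D (fun x => complex.Re (f x)) /\
  measurable_fun D (fun x => complex.Im (f x)).

(* The norm and the membership predicate of L^p(D, x^a dx), for D a measurable
   subset of R^+; elements are functions, not classes modulo a.e. equality. *)
Definition wLnorm (R : realType) (p : R) (D : set R) (a : R) (f : R -> R[i])
    : \bar R :=
  ((\int[lebesgue_measure]_(x in D)
      (ComplexField.Normc.normc (f x) `^ p * x `^ a)%:E) `^ p^-1)%E.

Definition in_wL (R : realType) (p : R) (D : set R) (a : R) (f : R -> R[i])
    : Prop :=
  cmeasurable D f /\ (wLnorm p D a f < +oo)%E.

Definition FBdom (R : realType) (nu r : R) (f : R -> R[i]) : Prop :=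
  if nu < - 2^-1 then
    in_wL 1 `]0, r[ (2 * nu + 1) f /\ in_wL 1 `]r, +oo[ (nu + 2^-1) f
  else in_wL 1 (Rplus R) (2 * nu + 1) f.

Definition fourier_bessel (R : realType) (nu : R) (f : R -> R[i]) : R -> R[i] :=
  fun y => cintegral (Rplus R)
    (fun x => (varphi nu (x * y))%:C * f x * (x `^ (2 * nu + 1))%:C).

Definition in_L2 (R : realType) (nu : R) (f : R -> R[i]) : Prop :=
  in_wL 2 (Rplus R) (2 * nu + 1) f.

Definition L2norm (R : realType) (nu : R) (f : R -> R[i]) : \bar R :=
  wLnorm 2 (Rplus R) (2 * nu + 1) f.

Definition L2dot (R : realType) (nu : R) (f g : R -> R[i]) : R[i] :=
  cintegral (Rplus R) (fun x => f x * (g x)^*%C * (x `^ (2 * nu + 1))%:C).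

(* An orthonormal family in L^2(R^+, x^(2 nu + 1) dx) with dense linear span. *)
Definition orthonormal_basis (R : realType) (nu : R) (e : nat -> R -> R[i])
    : Prop :=
  [/\ forall n, in_L2 nu (e n),
      forall m n, L2dot nu (e m) (e n) = (m == n)%:R
    & forall f, in_L2 nu f -> forall eps : R, 0 < eps ->
      exists (N : nat) (c : nat -> R[i]),
        (L2norm nu (fun x => f x - \sum_(k < N) c k * e k x)%R
           < eps%:E)%E].

Definition phi (R : realType) (nu : R) (n : nat) (x : R) : R :=
  (-1) ^+ n /
    Num.sqrt ((2 : R) ^ (4 * n%:Z - 1) * n`!%:R * Gamma (n%:R + nu + 1)) *
  expR (x ^+ 2 / 2) *
  iter n (bessel_op nu) (fun t => expR (- t ^+ 2)) x.

Definition phiC (R : realType) (nu : R) (n : nat) (x : R) : R[i] :=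
  (phi nu n x)%:C.

(* Main.v *)
Require Import Defs.
From HB Require Import structures.
From mathcomp Require Import all_boot all_order all_algebra.
From mathcomp Require Import all_classical all_reals all_analysis.
From mathcomp Require Import complex.
From mathcomp Require Import measurable_realfun.
From mathcomp Require Import ring lra.

(** Put [t = x ^+ 2]. On functions [P(t) * exp (- t)] the operator [Delta_nu]
    acts as the second-order operator [lagop] on the polynomial [P], so that
    [phi_n] is a multiple of [lag n (t) * exp (- t / 2)], where
    [lag n = lagop ^n 1] is a Laguerre polynomial up to scaling. The moments
    of the weight [exp (- x ^+ 2) * x ^ (2 nu + 1)] are values of Gamma, and
    [Gamma (s + 1) = s * Gamma s] makes [lagop] adjoint to the degree-lowering
    operator [lagstar], whence orthonormality.

    For the transform, integrate the power series of [varphi nu] termwise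
    against [P(t) * exp (- t / 2)]: the k-th term is [(- y ^+ 2 / 2) ^+ k / k!]
    times a linear functional of [P] (rising factorials). The k-th coefficient
    of [Q(y ^+ 2) * exp (- y ^+ 2 / 2)] in the same scale is another linear
    functional of [Q] (falling factorials). Under [lagop] these two functionals
    satisfy the same three-term recurrence in [k] up to sign, so on [lag n] they
    differ by [(-1) ^+ n].

    Completeness: the L2 closure of the polynomials in [t], for the weight above,
    contains [P(t) * exp (- i s t)] for [0 <= s <= 1/4] by induction on [i]
    (Taylor expansion of [exp (- s t)], dominated by [exp (t / 4)]), hence the
    polynomials in [exp (- s t)] for every [s >= 0]. The polynomials
    [1 - (1 - u ^+ n) ^+ (2 ^ n)] tend boundedly to the indicator of [u > 1/2],
    so the closure contains the indicators of rays, then those of all Borel sets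
    by Dynkin's lemma, then every function of L2. *)

Set Implicit Arguments.
Unset Strict Implicit.
Unset Printing Implicit Defensive.

Import Order.TTheory GRing.Theory Num.Theory.
Import numFieldNormedType.Exports.

Local Open Scope classical_set_scope.
Local Open Scope complex_scope.
Local Open Scope ring_scope.

(** * The Gamma integral *)

Lemma measurable_Rplus (R : realType) : measurable (Rplus R).
Proof. exact: measurable_itv. Qed.
Arguments measurable_Rplus R : clear implicits.
#[local] Hint Extern 0 (@measurable _ _ (Rplus _)) =>
  exact: measurable_Rplus : core.

Section gamma.
Context {R : realType}.
Implicit Types (f F G : R -> R) (s a b x t : R).
Local Notation mu := (@lebesgue_measure R).

Lemma RplusE x : Rplus R x = (0 < x) :> Prop.
Proof. by rewrite /Rplus /= in_itv/= andbT. Qed.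


Lemma near_pos x : 0 < x -> \forall z \near x, 0 < z.
Proof. by move=> x0; exact: lt_nbhsr. Qed.

Lemma derivable_pos_continuous F :
  (forall x, 0 < x -> derivable F x 1) ->
  forall x, 0 < x -> {for x, continuous F}.
Proof.
by move=> dF x x0; apply/differentiable_continuous/derivable1_diffP/dF.
Qed.

Lemma Rplus_continuous_measurable f :
  (forall x, 0 < x -> {for x, continuous f}) -> measurable_fun (Rplus R) f.
Proof.
move=> cf; apply: open_continuous_measurable_fun; first exact: interval_open.
by move=> x; rewrite inE/= RplusE => x0; exact: cf.
Qed.

Lemma within_pos_continuous f a b : 0 < a ->
  (forall x, 0 < x -> {for x, continuous f}) -> {within `[a, b], continuous f}.
Proof.
move=> a0 cf; apply: continuous_in_subspaceT => x; rewrite inE/= in_itv/=.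
by move=> /andP[ax _]; apply: cf; exact: lt_le_trans ax.
Qed.

Lemma pos_derivable_oo F a b : 0 < a -> a <= b ->
  (forall x, 0 < x -> derivable F x 1) -> derivable_oo_LRcontinuous F a b.
Proof.
move=> a0 ab dF; split.
- move=> x; rewrite in_itv/= => /andP[ax _].
  by apply: dF; exact: lt_trans ax.
- by apply/cvg_at_right_filter/derivable_pos_continuous.
- by apply/cvg_at_left_filter/derivable_pos_continuous; rewrite // (lt_le_trans a0).
Qed.

(* [u] and [v] are left free because [t = b * x ^+ 2] maps one exhaustion of R^+
   to another. *)
Lemma ge0_cvg_integral_exhaustion (u v : nat -> R) (f : R -> R) :
  (forall n, 0 < u n) -> {homo u : m n / (n <= m)%N >-> m <= n} ->
  {homo v : m n / (m <= n)%N >-> m <= n} ->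
  u @ \oo --> 0 -> v @ \oo --> +oo ->
  (forall x, 0 < x -> {for x, continuous f}) -> (forall x, 0 < x -> 0 <= f x) ->
  (\int[mu]_(x in `[u n, v n]) (f x)%:E @[n --> \oo] -->
   \int[mu]_(x in Rplus R) (f x)%:E)%E.
Proof.
move=> u0 nu nv cu cv cf f0.
have -> : Rplus R = \bigcup_n `[u n, v n]%classic.
  apply/seteqP; split=> x; rewrite RplusE.
    move=> x0.
    have h1 : \forall n \near \oo, u n <= x.
      by move/cvgrPdist_lt : cu => /(_ _ x0); apply: filterS => n;
        rewrite sub0r normrN gtr0_norm// => /ltW.
    have h2 : \forall n \near \oo, x <= v n.
      by move/cvgryPge : cv; exact.
    have [n _ /(_ n (leqnn n))[? ?]] := filterI h1 h2.
    by exists n => //=; rewrite in_itv/=; apply/andP.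
  by move=> [n _]; rewrite /= in_itv/= => /andP[+ _]; exact: lt_le_trans.
apply: ge0_nondecreasing_set_cvg_integral => //=.
- move=> m n mn; rewrite subsetEset => x; rewrite /= !in_itv/= => /andP[h1 h2].
  by rewrite (le_trans (nu _ _ mn) h1) (le_trans h2 (nv _ _ mn)).
- move=> n; apply/measurable_EFinP.
  apply: measurable_funS (Rplus_continuous_measurable cf) => //.
  move=> x /=; rewrite RplusE in_itv/= => /andP[+ _]; exact: lt_le_trans.
- move=> n x; rewrite in_itv/= lee_fin => /andP[h _].
  by apply: f0; exact: lt_le_trans (u0 n) h.
Qed.

(** The segments from [1 / (n + 1)] to [n + 2] exhaust R^+. The shift in [n.+2] keeps them
    nondegenerate already at [n = 0]. *)
Let uu (n : nat) : R := n.+1%:R^-1.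
Let vv (n : nat) : R := n.+2%:R.

Let uu0 n : 0 < uu n. Proof. by rewrite invr_gt0 ltr0n. Qed.
Let uuvv n : uu n < vv n.
Proof.
by rewrite (@le_lt_trans _ _ 1) ?invf_le1 ?ltr0n// ?ler1n// ltr1n.
Qed.
Let nuu : {homo uu : m n / (n <= m)%N >-> m <= n}.
Proof. by move=> m n mn; rewrite lef_pV2 ?posrE ?ltr0n// ler_nat. Qed.
Let nvv : {homo vv : m n / (m <= n)%N >-> m <= n}.
Proof. by move=> m n mn; rewrite ler_nat. Qed.
Let cuu : uu @ \oo --> 0. Proof. exact: cvg_harmonic. Qed.
Let cvv : vv @ \oo --> +oo.
Proof.
apply/cvgryPge => A; near=> n; apply: (@le_trans _ _ n%:R).
  by near: n; exact: nbhs_infty_ger.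
by rewrite ler_nat -addn2 leq_addr.
Unshelve. all: by end_near. Qed.

Let FTC F f n : (forall x, 0 < x -> {for x, continuous f}) ->
  (forall x, 0 < x -> is_derive x 1 F (f x)) ->
  (\int[mu]_(x in `[uu n, vv n]) (f x)%:E = (F (vv n))%:E - (F (uu n))%:E)%E.
Proof.
move=> cf dF; apply: continuous_FTC2 => //.
- exact: within_pos_continuous.
- by apply: pos_derivable_oo => //; [exact: ltW|move=> x x0; have [] := dF _ x0].
- move=> x; rewrite in_itv/= => /andP[h _].
  by rewrite derive1E; have [|_ ->] := dF x; first exact: lt_trans h.
Qed.

(** The fundamental theorem holds on each segment of the exhaustion; nonnegativity of [f] lets the
    integrals pass to the limit by monotone convergence. *)
Lemma ge0_FTC_Rplus F f (l0 l1 : R) : (forall x, 0 < x -> {for x, continuous f}) ->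
  (forall x, 0 < x -> 0 <= f x) ->
  (forall x, 0 < x -> is_derive x 1 F (f x)) ->
  F x @[x --> 0^'+] --> l0 -> F x @[x --> +oo] --> l1 ->
  (\int[mu]_(x in Rplus R) (f x)%:E = (l1 - l0)%:E)%E.
Proof.
move=> cf f0 dF F0 F1.
have h := ge0_cvg_integral_exhaustion uu0 nuu nvv cuu cvv cf f0.
apply: (cvg_unique _ h) => //.
rewrite /=. under eq_fun do rewrite (FTC _ cf dF) -EFinB.
apply: cvg_EFin; first exact: nearW.
apply: cvgB.
- exact: (cvg_comp _ _ cvv).
- by move/cvg_at_rightP : F0; apply; split.
Qed.

Lemma powR_continuous a x : 0 < x -> {for x, continuous (fun t : R => t `^ a)}.
Proof.
move=> x0; apply: derivable_pos_continuous (x0) => y y0.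
by have [] := @is_derive1_powR R a y y0.
Qed.

Lemma powR_exp_continuous a b x : 0 < x ->
  {for x, continuous (fun t : R => t `^ a * expR (- b * t))}.
Proof.
move=> x0; apply: continuousM; first exact: powR_continuous.
apply: (@continuous_comp _ _ _ (fun t : R => - b * t) expR).
  exact: mulrl_continuous.
exact: continuous_expR.
Qed.

(** * Euler's integral: functional equation, convergence, positivity *)

Let gi s t := t `^ (s - 1) * expR (- t).

Let gi_continuous s x : 0 < x -> {for x, continuous (gi s)}.
Proof.
have -> : gi s = (fun t => t `^ (s - 1) * expR (- 1 * t)).
  by apply/funext => t; rewrite mulN1r.
exact: powR_exp_continuous.
Qed.

Let gi_ge0 s x : 0 <= gi s x.
Proof. by rewrite mulr_ge0 ?powR_ge0 ?expR_ge0. Qed.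

(** Extended-real version of Euler's integral, so that the functional equation can be proved before
    finiteness is known. *)
Let Ie s := (\int[mu]_(x in Rplus R) (gi s x)%:E)%E.

Let is_derive_1mexp s x : 0 < x -> is_derive x 1
  (fun t => (1 - expR (- t)) `^ s) (s * (1 - expR (- x)) `^ (s - 1) * expR (- x)).
Proof.
move=> x0.
have h : is_derive x 1 (fun t => 1 - expR (- t)) (expR (- x)).
  by apply: is_derive_eq; rewrite mulrN1 opprK add0r mul1r.
have e0 : 0 < 1 - expR (- x) by rewrite subr_gt0 expR_lt1 oppr_lt0.
have h2 := @is_derive1_powR R s _ e0.
exact: (@is_derive1_comp R (fun t : R => t `^ s) (fun t : R => 1 - expR (- t))
  x _ _ h2 h).
Qed.

(** The derivative of [(1 - exp (- t)) ^ s] integrates to 1 over R^+. Since [1 - exp (- t) <= t], it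
    lies above [s * gi s] for [s <= 1] and below it for [s >= 1]. The first case yields convergence
    of the integral, the second positivity of Gamma. *)
Let Ie_cmp s : 0 < s ->
  ((s <= 1)%R -> s%:E * Ie s <= 1)%E /\ ((1 <= s)%R -> 1 <= s%:E * Ie s)%E.
Proof.
move=> s0.
pose F t := (1 - expR (- t)) `^ s.
pose f t := s * (1 - expR (- t)) `^ (s - 1) * expR (- t).
have e0 x : 0 < x -> 0 < 1 - expR (- x) by rewrite subr_gt0 expR_lt1 oppr_lt0.
have cexpN : continuous (fun t : R => expR (- t)).
  move=> x; apply: continuous_comp; last exact: continuous_expR.
  exact: continuousN.
have cf x : 0 < x -> {for x, continuous f}.
  move=> x0; apply: continuousM; last exact: cexpN.
  apply: continuousM; first exact: cvg_cst.
  apply: (@continuous_comp _ _ _ (fun t => 1 - expR (- t)) (fun t : R => t `^ (s - 1))).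
    by apply: continuousB; [exact: cvg_cst|exact: cexpN].
  exact/powR_continuous/e0.
have f0 x : 0 < x -> 0 <= f x.
  by move=> x0; rewrite !mulr_ge0 ?powR_ge0 ?expR_ge0// ltW.
have F0 : F x @[x --> 0^'+] --> (0 : R).
  have h : {for 0, continuous (fun t : R => 1 - expR (- t))}.
    by apply: continuousB; [exact: cvg_cst|exact: cexpN].
  apply/cvg_at_rightP => u [u0 cu].
  have := @powR_cvg0 R s s0; move/cvg_at_rightP => /(_ (fun n => 1 - expR (- u n))).
  apply; split; first by move=> n; exact: e0.
  have := continuous_cvg _ h cu; rewrite oppr0 expR0 subrr; exact.
have F1 : F x @[x --> +oo] --> (1 : R).
  have -> : (1 : R) = (1 - 0) `^ s by rewrite subr0 powR1.
  have hc : {for 1 - 0, continuous (fun t : R => t `^ s)}.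
    by apply: powR_continuous; rewrite subr0.
  apply: (continuous_cvg _ hc).
  by apply: cvgB; [exact: cvg_cst|exact: cvgr_expR].
have If : (\int[mu]_(x in Rplus R) (f x)%:E = (1 - 0)%:E)%E.
  by apply: (ge0_FTC_Rplus cf f0 _ F0 F1) => x x0; exact: is_derive_1mexp.
have mg : measurable_fun (Rplus R) (EFin \o gi s).
  by apply/measurable_EFinP; apply: Rplus_continuous_measurable; exact: gi_continuous.
have E : (\int[mu]_(x in Rplus R) (s * gi s x)%:E = s%:E * Ie s)%E.
  under eq_integral do rewrite EFinM.
  by rewrite ge0_integralZl_EFin// ?ltW// => x _; rewrite lee_fin gi_ge0.
have sg0 x : Rplus R x -> (0 <= (s * gi s x)%:E)%E.
  by move=> _; rewrite lee_fin mulr_ge0 ?gi_ge0// ltW.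
have msg : measurable_fun (Rplus R) (fun x => (s * gi s x)%:E).
  apply/measurable_EFinP; apply: Rplus_continuous_measurable => x x0.
  by apply: continuousM; [exact: cvg_cst|exact: gi_continuous].
have f0' x : Rplus R x -> (0 <= (f x)%:E)%E.
  by rewrite RplusE lee_fin; exact: f0.
have mf : measurable_fun (Rplus R) (fun x => (f x)%:E).
  by apply/measurable_EFinP; exact: Rplus_continuous_measurable.
have le x : 0 < x -> 1 - expR (- x) <= x.
  by move=> x0; rewrite lerBlDr -lerBlDl; have := @expR_ge1Dx R (- x).
have pw r x : 0 <= r -> 0 < x -> (1 - expR (- x)) `^ r <= x `^ r.
  by move=> r0 x0; apply: ge0_ler_powR; rewrite ?nnegrE ?le// ltW ?e0.
rewrite subr0 in If; rewrite -E -[1%E]/((1 : R)%:E) -If.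
split=> s1; apply: ge0_le_integral => //= x; rewrite RplusE => x0;
  rewrite lee_fin /f -mulrA ler_pM2l// ler_wpM2r ?expR_ge0//.
  (* For [s <= 1] the powers are inverses of powers of nonnegative exponent [1 - s], which reverses
     the comparison. *)
  rewrite -opprB !powRN lef_pV2 ?posrE ?powR_gt0 ?e0//.
  by apply: pw; rewrite ?subr_ge0.
by apply: pw; rewrite ?subr_ge0.
Qed.

(** This is [u <= exp u] at [u = c * t / s], raised to the power [s]. *)
Lemma powR_le_expR s c t : 0 < s -> 0 < c -> 0 < t ->
  t `^ s <= (s / c) `^ s * expR (c * t).
Proof.
move=> s0 c0 t0.
have -> : expR (c * t) = expR (c * t / s) `^ s by rewrite -expRM divfK// gt_eqF.
rewrite -powRM ?expR_ge0 ?divr_ge0 ?(ltW s0) ?(ltW c0)//.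
apply: ge0_ler_powR; rewrite ?nnegrE ?mulr_ge0 ?invr_ge0 ?expR_ge0 ?(ltW s0)
  ?(ltW c0) ?(ltW t0)//.
rewrite -ler_pdivrMl ?divr_gt0// invf_div mulrAC -mulrA [_ / s]mulrC mulrA.
by rewrite (le_trans _ (expR_ge1Dx _))// mulrC mulrA lerDr.
Qed.

Let cvg_gi_y s : 0 < s -> gi (s + 1) x @[x --> +oo] --> (0 : R).
Proof.
move=> s0.
apply: (@squeeze_cvgr _ _ _ _ (fun=> 0) (fun x => (s / 2^-1) `^ s * expR (- (2^-1 * x)))).
- near=> x; rewrite gi_ge0/= /gi addrK.
  have x0 : 0 < x by near: x; apply: nbhs_pinfty_gt; exact: num_real.
  have := @powR_le_expR s 2^-1 x s0; rewrite invr_gt0 ltr0n => /(_ isT x0) h.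
  rewrite (le_trans (ler_wpM2r (expR_ge0 _) h))// -mulrA -expRD.
  by rewrite ler_wpM2l ?powR_ge0// ler_expR; lra.
- exact: cvg_cst.
- rewrite -[X in _ --> X](mulr0 ((s / 2^-1) `^ s)); apply: cvgMr.
  apply: (@cvg_comp _ _ _ (fun x => 2^-1 * x) (fun z => expR (- z)) _ (pinfty_nbhs R));
    last exact: cvgr_expR.
  by apply: gt0_cvgMry.
Unshelve. all: by end_near. Qed.

Let cvg_gi_0 s : 0 < s -> gi (s + 1) x @[x --> 0^'+] --> (0 : R).
Proof.
move=> s0; rewrite -[X in _ --> X](mul0r (expR (- 0))); apply: cvgM.
  by rewrite addrK; exact: powR_cvg0.
apply: cvg_at_right_filter.
exact: (@continuous_comp _ _ _ (fun t : R => - t) _ _ (@continuousN _ _ _ _ _ cvg_id)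
  (@continuous_expR R _)).
Qed.

(** Integration by parts on each segment of the exhaustion; the boundary values of
    [t ^ s * exp (- t)] vanish at both ends of R^+. *)
Let IeS s : 0 < s -> (Ie (s + 1) = s%:E * Ie s)%E.
Proof.
move=> s0.
have h s' := ge0_cvg_integral_exhaustion uu0 nuu nvv cuu cvv
  (@gi_continuous s') (fun x _ => gi_ge0 s' x).
apply: (cvg_unique _ (h (s + 1))) => //=.
have int s' n : mu.-integrable `[uu n, vv n] (EFin \o gi s').
  apply: continuous_compact_integrable; first exact: segment_compact.
  exact/within_pos_continuous/gi_continuous.
have E n : (\int[mu]_(x in `[uu n, vv n]) (gi (s + 1) x)%:E =
    s%:E * \int[mu]_(x in `[uu n, vv n]) (gi s x)%:E +
    (gi (s + 1) (uu n) - gi (s + 1) (vv n))%:E)%E.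
  have d x : 0 < x -> is_derive x 1 (fun t => - gi (s + 1) t) (gi (s + 1) x - s * gi s x).
    move=> x0; rewrite /gi addrK.
    have h1 := @is_derive1_powR R s x x0.
    have h2 : is_derive x 1 (fun t : R => expR (- t)) (- expR (- x)).
      by apply: is_derive_eq; rewrite mulrN1.
    have h3 := is_deriveN (is_deriveM h1 h2).
    by apply: is_derive_eq h3 _; rewrite /GRing.scale/=; ring.
  have cd x : 0 < x -> {for x, continuous (fun t => gi (s + 1) t - s * gi s t)}.
    move=> x0; apply: continuousB; first exact: gi_continuous.
    by apply: continuousM; [exact: cvg_cst|exact: gi_continuous].
  have := @FTC _ _ n cd d.
  have i2 : mu.-integrable `[uu n, vv n] (EFin \o (fun x => s * gi s x)).
    apply: continuous_compact_integrable; first exact: segment_compact.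
    apply: within_pos_continuous => // x x0.
    by apply: continuousM; [exact: cvg_cst|exact: gi_continuous].
  under eq_integral do rewrite EFinB.
  rewrite integralB_EFin//=.
  under [X in (_ - X)%E]eq_integral do rewrite EFinM.
  rewrite integralZl//=; last exact: int.
  rewrite -(fineK (integrable_fin_num _ (int s n)))//.
  rewrite -(fineK (integrable_fin_num _ (int (s + 1) n)))//=.
  rewrite -EFinM -!EFinB => -[H]; rewrite -EFinD; congr EFin.
  by move/eqP: H; rewrite subr_eq => /eqP ->; rewrite opprK [RHS]addrC [- _ + _]addrC.
under eq_fun do rewrite E.
rewrite -[(s%:E * Ie s)%E]adde0; apply: cvgeD.
(* The boundary term has a finite limit, so the sum of the limits is defined even if [Ie s] were
   infinite. *)
- by rewrite fin_num_adde_defl.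
- by apply: cvgeZl => //; exact: h.
- have -> : 0%E = (0 - 0 : R)%:E by rewrite subr0.
  apply: cvg_EFin; first exact: nearW.
  apply: cvgB.
  + by have := cvg_gi_0 s0; move/cvg_at_rightP; apply.
  + exact: (cvg_comp _ _ cvv (cvg_gi_y s0)).
Qed.

Let Ie_ge0 s : (0 <= Ie s)%E.
Proof. by apply: integral_ge0 => x _; rewrite lee_fin gi_ge0. Qed.

(** For [s <= 1] finiteness comes from [Ie_cmp]; larger [s] are reduced by 1 at a time with
    [IeS]. *)
Let Ie_lty s : 0 < s -> (Ie s < +oo)%E.
Proof.
move=> s0; have [n] : exists n : nat, s <= n.+1%:R.
  exists (Num.bound s); apply/ltW/(lt_le_trans (archi_boundP (ltW s0))).
  by rewrite ler_nat.
move: s0 => /[swap]; elim: n s => [|n IH] s sn s0.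
  have [/(_ sn) + _] := Ie_cmp s0; case: (Ie s) => [r||]//=; rewrite ?ltry//.
  by rewrite gt0_muley ?lte_fin.
have [s1|s1] := leP s 1.
  have [/(_ s1) + _] := Ie_cmp s0; case: (Ie s) => [r||]//=; rewrite ?ltry//.
  by rewrite gt0_muley ?lte_fin.
have s10 : 0 < s - 1 by rewrite subr_gt0.
rewrite -(subrK 1 s) IeS// lte_mul_pinfty ?lee_fin ?ltW// IH//.
by rewrite lerBlDr -natr1 in sn *.
Qed.

Lemma integral_Gamma s : 0 < s ->
  (\int[mu]_(x in Rplus R) (x `^ (s - 1) * expR (- x))%:E = (Gamma s)%:E)%E.
Proof.
move=> s0; have -> : Gamma s = fine (Ie s) by [].
by rewrite fineK// (ge0_fin_numE (Ie_ge0 s)) Ie_lty.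
Qed.

Lemma GammaS s : 0 < s -> Gamma (s + 1) = s * Gamma s.
Proof.
move=> s0; apply: EFin_inj; rewrite EFinM -!integral_Gamma ?addr_gt0//.
exact: IeS.
Qed.

(** The lower bound of [Ie_cmp] requires an argument at least 1, so it is applied at [s + 1], and
    [GammaS] brings the sign back to [s]. *)
Lemma Gamma_gt0 s : 0 < s -> 0 < Gamma s.
Proof.
move=> s0; have s10 : 0 < s + 1 by rewrite addr_gt0.
have [_] := Ie_cmp s10; rewrite /Ie integral_Gamma// lerDr (ltW s0) => /(_ isT).
rewrite GammaS// -EFinM lee_fin => /(lt_le_trans ltr01).
by rewrite !pmulr_rgt0.
Qed.

(** The change of variables is done on each segment of the exhaustion. The image segments under
    [b * x ^+ 2] also exhaust R^+, so both integrals are limits of the same sequence. *)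
Lemma ge0_integral_quadratic_subst b G : 0 < b ->
  (forall t, 0 < t -> {for t, continuous G}) -> (forall t, 0 < t -> 0 <= G t) ->
  (\int[mu]_(t in Rplus R) (G t)%:E =
   \int[mu]_(x in Rplus R) (G (b * x ^+ 2) * (2 * b * x))%:E)%E.
Proof.
move=> b0 cG G0.
pose F x := b * x ^+ 2.
have Fpos x : 0 < x -> 0 < F x by move=> x0; rewrite mulr_gt0 ?exprn_gt0.
have dF x : is_derive x 1 F (2 * b * x).
  by apply: is_derive_eq; rewrite /GRing.scale/=; ring.
have F'E : F^`()%classic = (fun x => 2 * b * x).
  by apply/funext => x; rewrite derive1E derive_val.
have cF x : {for x, continuous F}.
  by apply/differentiable_continuous/derivable1_diffP; have [] := dF x.
have cF' : continuous (fun x : R => 2 * b * x).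
  exact: mulrl_continuous.
have cH x : 0 < x -> {for x, continuous (fun x => G (F x) * (2 * b * x))}.
  move=> x0; apply: continuousM; last exact: cF'.
  by apply: continuous_comp; [exact: cF|exact/cG/Fpos].
have H0 x : 0 < x -> 0 <= G (F x) * (2 * b * x).
  by move=> x0; rewrite !mulr_ge0 ?(ltW b0) ?(ltW x0)//; exact/G0/Fpos.
have hF x y : 0 < x -> x <= y -> F x <= F y.
  by move=> x0 xy; rewrite ler_pM2l// ler_pXn2r ?nnegrE ?(ltW x0) ?(le_trans (ltW x0)).
have h1 := ge0_cvg_integral_exhaustion uu0 nuu nvv cuu cvv cH H0.
have h2 : (\int[mu]_(x in `[F (uu n), F (vv n)]) (G x)%:E @[n --> \oo] -->
   \int[mu]_(x in Rplus R) (G x)%:E)%E.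
  apply: (@ge0_cvg_integral_exhaustion (F \o uu) (F \o vv)) => //=.
  - by move=> n; exact: Fpos.
  - by move=> m n mn; apply: hF => //; exact: nuu.
  - by move=> m n mn; apply: hF; [exact: ltr0Sn|exact: nvv].
  - have := continuous_cvg _ (cF 0) cuu; rewrite /F expr0n mulr0; exact.
  - apply: (@cvg_comp _ _ _ vv F _ (pinfty_nbhs R)) => //.
    apply: (@gt0_cvgMry _ _ _ _ (fun x => x ^+ 2)) => //; exact: cvgr_expr2.
apply: (cvg_unique _ h2) => //=; rewrite [X in X @ _](_ : _ =
  fun n => (\int[mu]_(x in `[uu n, vv n]) (G (F x) * (2 * b * x))%:E)%E) //.
apply/funext => n.
have hF1 : {in `[uu n, vv n] &, {homo F : x y / x < y}}.
  move=> x y; rewrite !in_itv/= => /andP[ux _] _ xy.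
  have x0 : 0 < x by exact: lt_le_trans ux.
  by rewrite ltr_pM2l// ltr_pXn2r ?nnegrE ?(ltW x0) ?(ltW (lt_trans x0 xy)).
have cF1 : {in `]uu n, vv n[, continuous F^`()%classic}.
  by rewrite F'E => x _; exact: cF'.
have cFu : cvg (F^`()%classic x @[x --> (uu n)^'+]).
  rewrite F'E; apply/cvg_ex; exists (2 * b * uu n).
  by apply: cvg_at_right_filter; exact: cF'.
have cFv : cvg (F^`()%classic x @[x --> (vv n)^'-]).
  rewrite F'E; apply/cvg_ex; exists (2 * b * vv n).
  by apply: cvg_at_left_filter; exact: cF'.
have dF1 : derivable_oo_LRcontinuous F (uu n) (vv n).
  have dFd x : derivable F x 1 by have [] := dF x.
  exact: (pos_derivable_oo (uu0 n) (ltW (uuvv n)) (fun x _ => dFd x)).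
have cG1 : {within `[F (uu n), F (vv n)], continuous G}.
  exact: within_pos_continuous (Fpos _ (uu0 n)) cG.
rewrite (integration_by_substitution_increasing (ltW (uuvv n)) hF1 cF1 cFu cFv dF1 cG1).
by apply: eq_integral => x _; rewrite F'E.
Qed.

Lemma integral_powR_gauss s b : 0 < s -> 0 < b ->
  (\int[mu]_(x in Rplus R) (x `^ (2 * s - 1) * expR (- b * x ^+ 2))%:E =
   (Gamma s / (2 * b `^ s))%:E)%E.
Proof.
move=> s0 b0; have h := integral_Gamma s0.
have bs0 : 0 < 2 * b `^ s by rewrite mulr_gt0 ?powR_gt0.
rewrite (ge0_integral_quadratic_subst b0 (@gi_continuous s)) in h; last first.
  by move=> t _; exact: gi_ge0.
rewrite [Gamma s / _]mulrC EFinM -h -ge0_integralZl_EFin//; last 3 first.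
- move=> x; rewrite RplusE => x0.
  by rewrite lee_fin !mulr_ge0 ?powR_ge0 ?expR_ge0// ltW.
- apply/measurable_EFinP; apply: Rplus_continuous_measurable => x x0.
  apply: continuousM; last first.
    by apply: continuousM; [exact: cvg_cst|exact: cvg_id].
  apply: (@continuous_comp _ _ _ (fun x => b * x ^+ 2) (gi s)).
    by apply: continuousM; [exact: cvg_cst|exact: exprn_continuous].
  by apply: gi_continuous; rewrite mulr_gt0 ?exprn_gt0.
- by rewrite invr_ge0 ltW.
apply: eq_integral => x; rewrite inE RplusE => x0; rewrite -EFinM; congr EFin.
rewrite /gi powRM ?exprn_ge0 ?(ltW x0) ?(ltW b0)// -powR_mulrn ?(ltW x0)//.
rewrite -powRrM -(mulr_powRB1 (ltW b0) s0).
have -> : x `^ (2 * s - 1) = x * x `^ (2%:R * (s - 1)).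
  rewrite -[X in _ = X * _]powRr1 ?(ltW x0)// -powRD ?(gt_eqF x0) ?implybT//.
  by congr (_ `^ _); ring.
have bs1 : b `^ (s - 1) != 0 by rewrite gt_eqF ?powR_gt0.
by rewrite mulNr; field; rewrite bs1 gt_eqF.
Qed.

End gamma.

(** * Laguerre polynomials *)

Section laguerre.
Context {R : realType} (nu : R).
Implicit Types (P Q : {poly R}) (m : nat -> R).

(** The linear functional on polynomials with ['X^i] sent to [m i]. Integrals against a weight and
    coefficients of power series in [y ^+ 2] are both of this form. *)
Definition moment m P : R := \sum_(i < size P) P`_i * m i.

Lemma moment_widen m P n : (size P <= n)%N -> moment m P = \sum_(i < n) P`_i * m i.
Proof.
move=> Pn; rewrite /moment (big_ord_widen _ (fun i => P`_i * m i) Pn).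
rewrite big_mkcond; apply: eq_bigr => i _.
by case: ltnP => // iP; rewrite nth_default ?mul0r.
Qed.

Lemma momentP m a P Q : moment m (a *: P + Q) = a * moment m P + moment m Q.
Proof.
pose n := maxn (size P) (size Q).
have h1 : (size P <= n)%N by rewrite leq_maxl.
have h2 : (size Q <= n)%N by rewrite leq_maxr.
have h3 : (size (a *: P + Q)%R <= n)%N.
  rewrite (leq_trans (size_polyD _ _))// geq_max h2 andbT.
  by rewrite (leq_trans (size_scale_leq _ _)).
rewrite !(@moment_widen _ _ n)// mulr_sumr -big_split/=.
by apply: eq_bigr => i _; rewrite coefD coefZ mulrDl mulrA.
Qed.

HB.instance Definition _ m := GRing.isLinear.Build R {poly R} R *%R (moment m)
  (fun a P Q => momentP m a P Q).

Lemma momentD m P Q : moment m (P + Q) = moment m P + moment m Q.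
Proof. exact: linearD. Qed.

Lemma momentZ m a P : moment m (a *: P) = a * moment m P.
Proof. exact: linearZ. Qed.

Lemma momentXn m n : moment m 'X^n = m n.
Proof.
rewrite (@moment_widen _ _ n.+1) ?size_polyXn// big_ord_recr/= coefXn eqxx mul1r.
rewrite big1 ?add0r// => i _; rewrite coefXn lt_eqF ?mul0r//.
exact: ltn_ord.
Qed.

(** With [D = d/dt - 1] this is [4 (t D^2 + (nu + 1) D)], that is [Delta_nu] in the variable
    [t = x ^+ 2] conjugated by [exp (- t)]. *)
Definition lagop P : {poly R} :=
  4 *: ('X * (P^`()^`() - 2 *: P^`() + P) + (nu + 1) *: (P^`() - P)).

Lemma lagop_linear : linear lagop.
Proof.
move=> a P Q; rewrite /lagop !(derivD, derivZ) -!mul_polyC.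
ring.
Qed.

HB.instance Definition _ := GRing.isLinear.Build R {poly R} {poly R} *:%R lagop
  lagop_linear.

Lemma lagopXn j : lagop 'X^j = 4 *: ((j%:R * (j%:R + nu)) *: 'X^(j.-1)
  - (2 * j%:R + nu + 1) *: 'X^j + 'X^(j.+1)).
Proof.
rewrite /lagop; case: j => [|[|j]].
- rewrite expr0 derivC deriv0 -!mul_polyC; ring.
- rewrite expr1 derivX derivC -!mul_polyC/= expr0 expr2; ring.
have -> : ('X^(j.+2) : {poly R})^`() = j.+2%:R *: ('X * 'X^j).
  by rewrite derivXn/= scaler_nat -exprS.
have -> : (j.+2%:R *: ('X * 'X^j) : {poly R})^`() = (j.+2%:R * j.+1%:R) *: 'X^j.
  by rewrite derivZ -exprS derivXn/= -[X in _ *: X]scaler_nat scalerA.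
have -> : ('X^(j.+3) : {poly R}) = 'X * 'X * 'X * 'X^j by rewrite !exprS !mulrA.
have -> : ('X^(j.+2) : {poly R}) = 'X * 'X * 'X^j by rewrite !exprS !mulrA.
rewrite /= exprS -!mul_polyC -!natr1.
move: ('X : {poly R}) ('X^j : {poly R}) => x y.
rewrite !polyCM !polyCD !polyC_natr; ring.
Qed.

Definition lag n : {poly R} := iter n lagop 1.

(** [Delta_nu] itself in the variable [t], acting on polynomials without the exponential factor. *)
Definition lagstar P : {poly R} := 4 *: ('X * P^`()^`() + (nu + 1) *: P^`()).

Lemma lagstar_linear : linear lagstar.
Proof.
move=> a P Q; rewrite /lagstar !(derivD, derivZ) -!mul_polyC.
ring.
Qed.

HB.instance Definition _ := GRing.isLinear.Build R {poly R} {poly R} *:%R lagstar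
  lagstar_linear.

Lemma lagstarXn j : lagstar 'X^j = (4 * j%:R * (j%:R + nu)) *: 'X^(j.-1).
Proof.
rewrite /lagstar; case: j => [|[|j]].
- rewrite expr0 derivC deriv0 -!mul_polyC; ring.
- rewrite expr1 derivX derivC -!mul_polyC/= expr0; ring.
have -> : ('X^(j.+2) : {poly R})^`() = j.+2%:R *: ('X * 'X^j).
  by rewrite derivXn/= scaler_nat -exprS.
have -> : (j.+2%:R *: ('X * 'X^j) : {poly R})^`() = (j.+2%:R * j.+1%:R) *: 'X^j.
  by rewrite derivZ -exprS derivXn/= -[X in _ *: X]scaler_nat scalerA.
rewrite /= exprS -!mul_polyC -!natr1.
move: ('X : {poly R}) ('X^j : {poly R}) => x y.
rewrite !polyCM !polyCD !polyC_natr; ring.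
Qed.

(** * Adjointness of [lagop] and [lagstar] *)

Section orthogonality.
Variable m : nat -> R.
Hypothesis mS : forall k, m k.+1 = (k%:R + nu + 1) * m k.

(** For the weight [t ^ nu * exp (- t)] this says that the derivative of
    [t ^ (nu + 1) * exp (- t) * P(t)] has integral 0. On monomials it is exactly [mS]. *)
Lemma moment_ibp P : moment m ('X * P^`() - 'X * P + (nu + 1) *: P) = 0.
Proof.
rewrite -[P]coefK poly_def.
elim/big_ind : _ => [|A B hA hB|i _].
- by rewrite deriv0 !mulr0 subrr scaler0 addr0 linear0.
- transitivity (moment m ('X * A^`() - 'X * A + (nu + 1) *: A) +
    moment m ('X * B^`() - 'X * B + (nu + 1) *: B)); last by rewrite hA hB addr0.
  rewrite -linearD/=.
  congr moment; rewrite derivD -!mul_polyC; ring.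
have -> : 'X * (P`_i *: 'X^i)^`() - 'X * (P`_i *: 'X^i) + (nu + 1) *: (P`_i *: 'X^i) =
   P`_i *: ((i%:R + nu + 1) *: 'X^i - 'X^(i.+1)).
  have E : 'X * ('X^i : {poly R})^`() = i%:R%:P * 'X^i.
    rewrite derivXn; case: (nat_of_ord i) => [|j] /=.
      by rewrite mulr0n mulr0 polyC0 mul0r.
    by rewrite -mulr_natl mulrCA -exprS polyC_natr.
  rewrite derivZ -scalerAr E exprS -!mul_polyC.
  move: (P`_i)%:P ('X : {poly R}) ('X^i : {poly R}) => c x y.
  rewrite !polyCD; ring.
by rewrite linearZ/= linearB/= linearZ/= !momentXn mS subrr mulr0.
Qed.

(** Green's identity: the difference of the two sides is [moment_ibp] applied to the boundary
    expression [4 (P' Q - P Q - P Q')]. *)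
Lemma moment_adj P Q : moment m (lagop P * Q) = moment m (P * lagstar Q).
Proof.
apply/eqP; rewrite -subr_eq0 -linearB/=.
rewrite -(moment_ibp (4 *: (P^`() * Q - P * Q - P * Q^`()))); apply/eqP.
congr moment; rewrite /lagop /lagstar derivZ !derivB !derivM -!mul_polyC; ring.
Qed.

Lemma moment_lagM n Q : moment m (lag n * Q) = moment m (iter n lagstar Q).
Proof.
by elim: n Q => [|n IH] Q; rewrite ?mul1r//= moment_adj IH -iterSr.
Qed.

Lemma iter_lagstar_linear n : linear (iter n lagstar).
Proof.
by elim: n => [//|n IH] a P Q; rewrite !iterS IH linearP.
Qed.

HB.instance Definition _ n := GRing.isLinear.Build R {poly R} {poly R} *:%R
  (iter n lagstar) (iter_lagstar_linear n).

(** [lagstar] lowers the degree by one and kills constants: in [lagstarXn] the factor [j] vanishes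
    at [j = 0], where [j.-1] is only a default value. *)
Lemma iter_lagstarXn n k : (k < n)%N -> iter n lagstar 'X^k = 0.
Proof.
elim: n k => // n IH [|k] kn; rewrite iterSr lagstarXn linearZ/=.
  by rewrite mulr0 mul0r scale0r.
by rewrite IH ?scaler0.
Qed.

Lemma iter_lagstar_size n Q : (size Q <= n)%N -> iter n lagstar Q = 0.
Proof.
move=> Qn; rewrite -[Q]coefK poly_def linear_sum big1// => i _.
by rewrite linearZ/= iter_lagstarXn ?scaler0// (leq_trans (ltn_ord i)).
Qed.

Lemma moment_iter_lagstarXn n :
  moment m (iter n lagstar 'X^n) = 4 ^+ n * n`!%:R * m n.
Proof.
elim: n => [|n IH]; first by rewrite /= (momentXn m 0) !mul1r.
rewrite iterSr lagstarXn /= linearZ/= linearZ/= IH mS factS natrM exprS -natr1.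
ring.
Qed.

End orthogonality.

(** The leading term comes from the summand ['X^(j.+1)] of [lagopXn]. It determines the norm of
    [lag n] and makes the passage from monomials to the [lag k] triangular. *)
Lemma lagE n : exists2 L : {poly R}, (size L <= n)%N & lag n = 4 ^+ n *: 'X^n + L.
Proof.
elim: n => [|n [L Ln E]]; first by exists 0; rewrite ?size_poly0// scale1r addr0.
have size_lagop P : (size (lagop P) <= (size P).+1)%N.
  rewrite -{1}[P]coefK poly_def linear_sum.
  apply: (leq_trans (size_sum _ _ _)); apply/bigmax_leqP => i _.
  rewrite linearZ/= (leq_trans (size_scale_leq _ _))// lagopXn.
  rewrite (leq_trans (size_scale_leq _ _))//.
  rewrite (leq_trans (size_polyD _ _))// geq_max size_polyXn andbC ltnS ltn_ord/=.
  rewrite (leq_trans (size_polyD _ _))// size_polyN geq_max.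
  rewrite !(leq_trans (size_scale_leq _ _))// size_polyXn.
    by rewrite (leq_trans (ltn_ord i)).
  by rewrite (leq_ltn_trans (leq_pred _)) ?(leq_trans (ltn_ord i)).
exists (lagop L + 4 ^+ n.+1 *: ((n%:R * (n%:R + nu)) *: 'X^(n.-1)
  - (2 * n%:R + nu + 1) *: 'X^n)); last first.
  rewrite [lag _]iterS -/(lag n) E linearD linearZ/= lagopXn.
  by rewrite scalerA -exprSr scalerDr addrAC addrC [lagop L + _]addrC.
rewrite (leq_trans (size_polyD _ _))// geq_max.
rewrite (leq_trans (size_lagop _))//=.
rewrite (leq_trans (size_scale_leq _ _))//.
rewrite (leq_trans (size_polyD _ _))// size_polyN geq_max.
by rewrite !(leq_trans (size_scale_leq _ _))// size_polyXn// ltnS leq_pred.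
Qed.

Lemma size_lag n : (size (lag n) <= n.+1)%N.
Proof.
have [L Ln ->] := lagE n; rewrite (leq_trans (size_polyD _ _))// geq_max.
by rewrite (leq_trans (size_scale_leq _ _)) ?size_polyXn//= ltnW.
Qed.

(** The factor of larger index [j] is moved across as [j] copies of [lagstar], which kill every
    degree below [j]. If [i = j] only the leading term survives: one [4 ^+ i] is its coefficient,
    the other comes from [moment_iter_lagstarXn]. *)
Lemma moment_lag_orth m (mS : forall k, m k.+1 = (k%:R + nu + 1) * m k) i j :
  moment m (lag i * lag j) = if i == j then 16 ^+ i * i`!%:R * m i else 0.
Proof.
wlog ij : i j / (i <= j)%N.
  move=> H; case: (leqP i j) => [|/ltnW] ij; first exact: H.
  by rewrite mulrC H// eq_sym; case: eqP => [->|].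
have [<-|neq] := eqVneq i j.
  rewrite moment_lagM//; have [L Li ->] := lagE i.
  rewrite linearD/= linearZ/= (iter_lagstar_size Li) addr0 linearZ/=.
  rewrite moment_iter_lagstarXn// !mulrA -exprMn; congr (_ ^+ _ * _ * _); ring.
rewrite mulrC moment_lagM// iter_lagstar_size ?linear0//.
by rewrite (leq_trans (size_lag i))// ltn_neqAle neq.
Qed.

(** Triangular elimination: subtracting the right multiple of [lag n] removes the coefficient of
    ['X^n]. *)
Lemma lag_span P : exists c : nat -> R, P = \sum_(k < size P) c k *: lag k.
Proof.
suff H n : (size P <= n)%N -> exists c : nat -> R, P = \sum_(k < n) c k *: lag k.
  exact: H.
elim: n P => [|n IH] P Pn.
  by exists (fun=> 0); rewrite big_ord0; apply/size_poly_leq0P.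
have [L Ln E] := lagE n.
pose a : R := P`_n / 4 ^+ n.
have /IH[c cE] : (size (P - a *: lag n)%R <= n)%N.
  apply/leq_sizeP => i ni; rewrite coefB coefZ E coefD coefZ coefXn.
  move: ni; rewrite leq_eqVlt => /predU1P[<-|ni].
    rewrite eqxx mulr1 (nth_default 0 Ln) addr0 /a divfK ?subrr//.
  rewrite gtn_eqF// mulr0 add0r (nth_default 0 (leq_trans Pn ni)).
  by rewrite (nth_default 0 (leq_trans Ln (ltnW ni))) mulr0 subr0.
exists (fun k => if (k < n)%N then c k else a).
rewrite big_ord_recr/= ltnn -[LHS](subrK (a *: lag n)) cE; congr (_ + _).
by apply: eq_bigr => i _; rewrite ltn_ord.
Qed.

(** * Rising and falling factorial functionals *)

Section fourier_coefficients.

(* [rfpow c j] is 2^j times the rising factorial of c. *)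
Definition rfpow (c : R) j : R := \prod_(i < j) (2 * (c + i%:R)).

Lemma rfpowS c j : rfpow c j.+1 = 2 * (c + j%:R) * rfpow c j.
Proof. by rewrite /rfpow big_ord_recr/= mulrC. Qed.

Lemma rfpowSl c j : rfpow c j.+1 = 2 * c * rfpow (c + 1) j.
Proof.
rewrite /rfpow big_ord_recl/= addr0; congr (_ * _); apply: eq_bigr => i _.
by rewrite /bump/= natrD; ring.
Qed.

(** A signed falling factorial, scaled so that the sum over [k] of [u ^+ k / k! * ffpow k i] is
    [(- 2 * u) ^+ i * exp u]. At [u = - y ^+ 2 / 2] this is [y ^ (2 i) * exp (- y ^+ 2 / 2)]. *)
Definition ffpow (k : nat) i : R := (- 2) ^+ i * (k ^_ i)%:R.

Lemma ffpowS k i : ffpow k i.+1 = - 2 * (k%:R - i%:R) * ffpow k i.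
Proof.
rewrite /ffpow ffactnSr natrM exprS.
have [ik|ki] := leqP i k; first by rewrite natrB//; ring.
by rewrite ffact_small// !(mul0r, mulr0).
Qed.

Lemma ffpowSS k i : ffpow k.+1 i.+1 = - 2 * k.+1%:R * ffpow k i.
Proof. rewrite /ffpow ffactSS natrM exprS; ring. Qed.

Lemma ffpow_pred k i : k%:R * ffpow k.-1 i = (k%:R - i%:R) * ffpow k i.
Proof.
have n2 : (- 2 : R) != 0 by rewrite oppr_eq0 pnatr_eq0.
apply: (mulfI n2); rewrite [RHS]mulrA -ffpowS mulrA.
case: k => [|k]; last by rewrite ffpowSS.
by rewrite !(mulr0, mul0r) /ffpow ffact0n mulr0.
Qed.

(** By linearity this is a contiguity relation between rising factorials with neighbouring bases. At
    [k = 0] the factor [k] cancels the term where [k.-1] is a default value. *)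
Lemma moment_rfpow_lagop (k : nat) P :
  moment (rfpow (k%:R + nu + 1)) (lagop P) =
  2 * ((k%:R + nu + 1) * moment (rfpow (k.+1%:R + nu + 1)) P
   + (2 * k%:R + nu + 1) * moment (rfpow (k%:R + nu + 1)) P
   + k%:R * moment (rfpow (k.-1%:R + nu + 1)) P).
Proof.
rewrite -[P]coefK poly_def !linear_sum/=.
rewrite !mulr_sumr -!big_split/= mulr_sumr; apply: eq_bigr => i _.
rewrite [lagop _]linearZ/= lagopXn -scaleNr !(momentZ, momentD) !momentXn.
transitivity (P`_i * (2 * ((k%:R + nu + 1) * rfpow (k.+1%:R + nu + 1) i
  + (2 * k%:R + nu + 1) * rfpow (k%:R + nu + 1) i
  + k%:R * rfpow (k.-1%:R + nu + 1) i))); last by ring.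
congr (_ * _); case: (nat_of_ord i) => [|j].
  rewrite rfpowS /rfpow !big_ord0/=; ring.
rewrite !rfpowS /= -!natr1; set c := k%:R + nu + 1.
(* [h1] and [h2] bring the bases shifted up and down by 1 back to [c]. The factor [k] kept in [h2]
   covers [k = 0]. *)
have h1 : 2 * c * rfpow (k%:R + 1 + nu + 1) j = 2 * (c + j%:R) * rfpow c j.
  by rewrite -rfpowS rfpowSl; congr (_ * rfpow _ _); rewrite /c; ring.
have h2 : k%:R * (2 * (k.-1%:R + nu + 1 + j%:R) * rfpow (k.-1%:R + nu + 1) j) =
    k%:R * (2 * (k%:R + nu) * rfpow c j).
  case: k @c h1 => [|k] c h1; first by rewrite !mul0r.
  rewrite -rfpowS rfpowSl /c -natr1/=.
  by congr (_ * (_ * _ * rfpow _ _)); ring.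
transitivity (2 * ((c + 1 + j%:R) * (2 * c * rfpow (k%:R + 1 + nu + 1) j) +
   (2 * k%:R + nu + 1) * (2 * (c + j%:R) * rfpow c j)
   + k%:R * (2 * (k.-1%:R + nu + 1 + j%:R) * rfpow (k.-1%:R + nu + 1) j))).
  rewrite h1 h2 /c; ring.
rewrite /c; ring.
Qed.

Lemma moment_ffpow_lagop (k : nat) P :
  moment (ffpow k) (lagop P) =
  - 2 * ((k%:R + nu + 1) * moment (ffpow k.+1) P
   + (2 * k%:R + nu + 1) * moment (ffpow k) P + k%:R * moment (ffpow k.-1) P).
Proof.
rewrite -[P]coefK poly_def !linear_sum/=.
rewrite !mulr_sumr -!big_split/= mulr_sumr; apply: eq_bigr => i _.
rewrite [lagop _]linearZ/= lagopXn -scaleNr !(momentZ, momentD) !momentXn.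
transitivity (P`_i * (- 2 * ((k%:R + nu + 1) * ffpow k.+1 i
  + (2 * k%:R + nu + 1) * ffpow k i + k%:R * ffpow k.-1 i))); last by ring.
rewrite ffpow_pred; congr (_ * _); case: (nat_of_ord i) => [|j].
  rewrite ffpowS /ffpow !ffactn0 !expr0/=; ring.
rewrite ffpowSS !ffpowS /= -!natr1; ring.
Qed.

(** Both functionals take the value 1 on [lag 0 = 1], and their recurrences under [lagop] differ
    only in sign. The induction is for all [k] at once because the recurrences involve the
    neighbours of [k]. *)
Lemma moment_rfpow_lag n (k : nat) :
  moment (rfpow (k%:R + nu + 1)) (lag n) = (- 1) ^+ n * moment (ffpow k) (lag n).
Proof.
elim: n k => [|n IH] k.
  by rewrite /lag/= !(momentXn _ 0) /rfpow big_ord0 /ffpow ffactn0 !mulr1.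
rewrite [lag _]iterS -/(lag n) moment_rfpow_lagop moment_ffpow_lagop !IH exprS.
ring.
Qed.

End fourier_coefficients.

End laguerre.

(** * Gaussian moments *)

Section gaussian_moments.
Context {R : realType}.
Implicit Types (P : {poly R}) (f g : R -> R) (nu b x : R).
Local Notation mu := (@lebesgue_measure R).

(** * Integration on R^+ *)

Lemma Rplus_integrable_eq f g : (forall x, 0 < x -> f x = g x) ->
  mu.-integrable (Rplus R) (EFin \o f) -> mu.-integrable (Rplus R) (EFin \o g).
Proof.
move=> fg; apply: eq_integrable => // x.
by rewrite inE RplusE => x0; rewrite /= fg.
Qed.

Lemma Rplus_Rintegral_eq f g : (forall x, 0 < x -> f x = g x) ->
  \int[mu]_(x in Rplus R) f x = \int[mu]_(x in Rplus R) g x.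
Proof.
by move=> fg; apply: eq_Rintegral => x; rewrite inE RplusE; exact: fg.
Qed.

Lemma Rplus_integrableD f g :
  mu.-integrable (Rplus R) (EFin \o f) -> mu.-integrable (Rplus R) (EFin \o g) ->
  mu.-integrable (Rplus R) (EFin \o (fun x => f x + g x)).
Proof. by move=> hf hg; exact: (@integrableD _ _ _ _ _ _ _ _ hf hg). Qed.

Lemma Rplus_integrableZ a f : mu.-integrable (Rplus R) (EFin \o f) ->
  mu.-integrable (Rplus R) (EFin \o (fun x => a * f x)).
Proof. by move=> hf; exact: (@integrableZl _ _ _ _ _ _ a _ hf). Qed.

Lemma Rplus_integrable_le f g : measurable_fun (Rplus R) f ->
  (forall x, 0 < x -> `|f x| <= g x) -> mu.-integrable (Rplus R) (EFin \o g) ->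
  mu.-integrable (Rplus R) (EFin \o f).
Proof.
move=> mf fg; apply: le_integrable => //; first exact/measurable_EFinP.
by move=> x; rewrite RplusE => /fg h; rewrite /= lee_fin (le_trans h)// ler_norm.
Qed.

(** One exceptional point [a], a null set, is allowed for the sake of [C_ray], where convergence to
    the indicator fails at the end of the ray. *)
Lemma Rplus_dominated_cvg (f_ : nat -> R -> R) f g (a : R) :
  (forall n, measurable_fun (Rplus R) (f_ n)) -> measurable_fun (Rplus R) f ->
  (forall x, 0 < x -> x != a -> f_ ^~ x @ \oo --> f x) ->
  mu.-integrable (Rplus R) (EFin \o g) ->
  (forall n x, 0 < x -> `|f_ n x| <= g x) ->
  \int[mu]_(x in Rplus R) f_ n x @[n --> \oo] --> \int[mu]_(x in Rplus R) f x.
Proof.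
move=> mf_ mf f_f ig f_g.
have h3 : {ae mu, forall x, Rplus R x -> EFin (f_ n x) @[n --> \oo] --> EFin (f x)}.
  exists [set a]; split; [exact: measurable_set1|exact: lebesgue_measure_set1|].
  move=> x /=; apply: contra_notP => /eqP xa; rewrite RplusE => x0.
  by apply: cvg_EFin; [exact: nearW|exact: f_f].
have h5 : {ae mu, forall x n, Rplus R x -> (`|(f_ n x)%:E| <= (g x)%:E)%E}.
  by apply: aeW => x n; rewrite RplusE => x0; rewrite lee_fin f_g.
have h1 n : measurable_fun (Rplus R) (EFin \o f_ n) by exact/measurable_EFinP.
have h2 : measurable_fun (Rplus R) (EFin \o f) by exact/measurable_EFinP.
have [if_ _ h] := @dominated_convergence _ _ R mu (Rplus R) (measurable_Rplus R)
  (fun n => EFin \o f_ n) (EFin \o f) (EFin \o g) h1 h2 h3 ig h5.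
by apply: fine_cvg; rewrite fineK//; exact: integrable_fin_num.
Qed.

(** * The Bessel operator on Gaussians times polynomials *)

Lemma derive1_ext f g x : (forall t, 0 < t -> f t = g t) -> 0 < x ->
  f^`()%classic x = g^`()%classic x.
Proof.
move=> fg x0; rewrite !derive1E; apply: near_eq_derive.
by near=> z; apply: fg; near: z; exact: near_pos.
Unshelve. all: by end_near. Qed.

Lemma bessel_op_ext nu f g x : (forall t, 0 < t -> f t = g t) -> 0 < x ->
  bessel_op nu f x = bessel_op nu g x.
Proof.
move=> fg x0; rewrite /bessel_op /derive1n /= (derive1_ext fg x0).
by rewrite (@derive1_ext _ (g^`()%classic) x _ x0)// => t; exact: derive1_ext.
Qed.

Lemma is_derive_poly_gauss P x :
  is_derive x 1 (fun t => P.[t ^+ 2] * expR (- t ^+ 2))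
    (2 * x * (P^`() - P).[x ^+ 2] * expR (- x ^+ 2)).
Proof.
have h1 : is_derive x 1 (fun t : R => t ^+ 2) (2 * x).
  by apply: is_derive_eq; rewrite /GRing.scale/=; ring.
have h2 : is_derive x 1 (fun t : R => P.[t ^+ 2]) (P^`().[x ^+ 2] * (2 * x)).
  have hp := is_derive_poly P (x ^+ 2).
  exact: (@is_derive1_comp R (horner P) (fun t => t ^+ 2) x _ _ hp h1).
have h3 : is_derive x 1 (fun t : R => expR (- t ^+ 2)) (expR (- x ^+ 2) * (- (2 * x))).
  have he := is_derive_expR (- x ^+ 2).
  exact: (@is_derive1_comp R expR (fun t => - t ^+ 2) x _ _ he (is_deriveN h1)).
have h4 := is_deriveM h2 h3.
by apply: is_derive_eq h4 _; rewrite hornerD hornerN /GRing.scale/=; ring.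
Qed.

(** The first derivative carries a factor [2 * x], which cancels the division by [x], so the result
    depends on [x ^+ 2] alone apart from the identity [x / x = 1]. *)
Lemma bessel_op_poly_gauss nu P x : 0 < x ->
  bessel_op nu (fun t => P.[t ^+ 2] * expR (- t ^+ 2)) x =
  (lagop nu P).[x ^+ 2] * expR (- x ^+ 2).
Proof.
move=> x0; rewrite /bessel_op /derive1n /=.
have d1 (Q : {poly R}) : (fun t : R => Q.[t ^+ 2] * expR (- t ^+ 2))^`()%classic =
    (fun t => 2 * t * (Q^`() - Q).[t ^+ 2] * expR (- t ^+ 2)).
  by apply/funext => t; rewrite derive1E; have [_ ->] := is_derive_poly_gauss Q t.
set Q := P^`() - P.
have h1 : is_derive x 1 (fun t : R => 2 * t) 2.
  by apply: is_derive_eq; rewrite /GRing.scale/=; ring.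
have h2 := is_deriveM h1 (is_derive_poly_gauss Q x).
rewrite (d1 P) -/Q.
have -> : (fun t => 2 * t * Q.[t ^+ 2] * expR (- t ^+ 2)) =
    (fun t : R => 2 * t) * (fun t => Q.[t ^+ 2] * expR (- t ^+ 2)).
  by apply/funext => t; rewrite mulrA.
rewrite derive1E; have [_ ->] := h2.
rewrite /GRing.scale/= /lagop /Q !(derivB, hornerD, hornerN, hornerZ, hornerM, hornerX).
field.
by rewrite gt_eqF.
Qed.

Lemma iter_bessel_op_gauss nu n x : 0 < x ->
  iter n (bessel_op nu) (fun t => expR (- t ^+ 2)) x =
  (lag nu n).[x ^+ 2] * expR (- x ^+ 2).
Proof.
elim: n x => [|n IH] x x0; first by rewrite /= hornerC mul1r.
by rewrite iterS (bessel_op_ext _ IH x0) bessel_op_poly_gauss.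
Qed.

Definition phi_coef nu (n : nat) : R :=
  (-1) ^+ n / Num.sqrt ((2 : R) ^ (4 * n%:Z - 1) * n`!%:R * Gamma (n%:R + nu + 1)).

Lemma phiE nu n x : 0 < x ->
  phi nu n x = phi_coef nu n * (lag nu n).[x ^+ 2] * expR (- 2^-1 * x ^+ 2).
Proof.
move=> x0; rewrite /phi iter_bessel_op_gauss// -/(phi_coef nu n).
have -> : expR (- 2^-1 * x ^+ 2) = expR (x ^+ 2 / 2) * expR (- x ^+ 2).
  by rewrite -expRD; congr expR; field.
ring.
Qed.

Section fixed_order.
Variables (nu : R) (hnu : -1 < nu).

Let nu1 (k : nat) : 0 < k%:R + nu + 1.
Proof. by rewrite -addrA addrC ltr_wpDr// -ltrBlDr sub0r. Qed.

Definition gmoment b (k : nat) : R :=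
  Gamma (k%:R + nu + 1) / (2 * b `^ (k%:R + nu + 1)).

Lemma gmoment1S k : gmoment 1 k.+1 = (k%:R + nu + 1) * gmoment 1 k.
Proof.
have E : Gamma (k.+1%:R + nu + 1) = (k%:R + nu + 1) * Gamma (k%:R + nu + 1).
  by rewrite -(GammaS (nu1 k)); congr Gamma; rewrite -natr1; ring.
by rewrite /gmoment E !powR1 mulrA.
Qed.

(** The rate [b] is 1 for products of two [phi], [1/2] for a single one, and [3/8] for the majorant
    in the transform. *)
Definition pgw b P x : R := P.[x ^+ 2] * expR (- b * x ^+ 2) * x `^ (2 * nu + 1).

Lemma pgw_continuous b P x : 0 < x -> {for x, continuous (pgw b P)}.
Proof.
move=> x0; apply: continuousM; last exact: powR_continuous.
have c2 : {for x, continuous (fun t : R => t ^+ 2)} by exact: exprn_continuous.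
apply: continuousM.
  by apply: (continuous_comp c2); exact: continuous_horner.
apply: (@continuous_comp _ _ _ (fun t : R => - b * t ^+ 2) expR).
  by apply: (continuous_comp c2); exact: mulrl_continuous.
exact: continuous_expR.
Qed.

Lemma measurable_pgw b P : measurable_fun (Rplus R) (pgw b P).
Proof. by apply: Rplus_continuous_measurable => x; exact: pgw_continuous. Qed.

Lemma pgw_integral b P : 0 < b -> mu.-integrable (Rplus R) (EFin \o pgw b P) /\
  \int[mu]_(x in Rplus R) pgw b P x = moment (gmoment b) P.
Proof.
move=> b0; rewrite -[P]coefK poly_def.
elim/big_ind : _ => [|A B [iA eA] [iB eB]|i _].
- rewrite linear0; have -> : pgw b 0 = (fun=> 0).
    by apply/funext => x; rewrite /pgw horner0 !mul0r.
  by split; [exact: integrable0|rewrite /Rintegral integral0].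
- have -> : pgw b (A + B) = (fun x => pgw b A x + pgw b B x).
    by apply/funext => x; rewrite /pgw hornerD !mulrDl.
  split; last by rewrite RintegralD// eA eB momentD.
  exact: Rplus_integrableD.
(* The monomial case is [integral_powR_gauss] at [s = i + nu + 1], as [2 i + 2 nu + 1 = 2 s - 1]. *)
have pE x : 0 < x -> pgw b (P`_i *: 'X^i) x =
    P`_i * (x `^ (2 * (i%:R + nu + 1) - 1) * expR (- b * x ^+ 2)).
  move=> x0; rewrite /pgw hornerZ hornerXn -!mulrA; congr (_ * _).
  rewrite mulrCA mulrC; congr (_ * _).
  rewrite -exprM -powR_mulrn ?ltW// -powRD ?(gt_eqF x0) ?implybT//.
  by congr (_ `^ _); rewrite natrM; ring.
have ige := integral_powR_gauss (nu1 i) b0.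
have mg : measurable_fun (Rplus R)
    (fun x => x `^ (2 * (i%:R + nu + 1) - 1) * expR (- b * x ^+ 2)).
  apply: Rplus_continuous_measurable => x x0.
  apply: continuousM; first exact: powR_continuous.
  apply: (@continuous_comp _ _ _ (fun t : R => - b * t ^+ 2) expR).
    apply: (@continuous_comp _ _ _ (fun t : R => t ^+ 2)).
      exact: exprn_continuous.
    exact: mulrl_continuous.
  exact: continuous_expR.
have ig : mu.-integrable (Rplus R)
    (EFin \o (fun x => x `^ (2 * (i%:R + nu + 1) - 1) * expR (- b * x ^+ 2))).
  apply/integrableP; split; first exact/measurable_EFinP.
  under eq_integral => x _ do rewrite /= ger0_norm ?mulr_ge0 ?powR_ge0 ?expR_ge0//.
  by rewrite ige ltry.
split.
  apply: Rplus_integrable_eq (Rplus_integrableZ P`_i ig) => x x0.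
  by rewrite pE.
rewrite (@Rplus_Rintegral_eq _ (fun x => P`_i * (x `^ (2 * (i%:R + nu + 1) - 1) *
  expR (- b * x ^+ 2))))//.
by rewrite RintegralZl// momentZ momentXn /Rintegral ige.
Qed.

End fixed_order.
End gaussian_moments.

(** * Orthonormality *)

Section orthonormality.
Context {R : realType}.
Implicit Types (P : {poly R}) (f g : R -> R) (nu b x : R).
Local Notation mu := (@lebesgue_measure R).

Lemma normc_real (x : R) : ComplexField.Normc.normc (x%:C) = `|x|.
Proof. by rewrite /= expr0n addr0 sqrtr_sqr. Qed.

Lemma cintegral_real (D : set R) f :
  cintegral D (fun x => (f x)%:C) = (\int[mu]_(x in D) f x)%:C.
Proof. by rewrite /cintegral /= /Rintegral integral0. Qed.

Lemma in_wL_integrable p (D : set R) a (f : R -> R[i]) :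
  measurable D -> D `<=` Rplus R -> cmeasurable (Rplus R) f ->
  mu.-integrable (Rplus R)
    (EFin \o (fun x => ComplexField.Normc.normc (f x) `^ p * x `^ a)) ->
  in_wL p D a f.
Proof.
move=> mD DR [mr mi] h; split.
  by split; [move: mr|move: mi]; exact: measurable_funS.
have hD := @integrableS _ _ _ mu _ _ _ (measurable_Rplus R) mD DR h.
rewrite /wLnorm poweR_lty//; exact: (@integrable_lty _ _ _ mu _ mD _ hD).
Qed.

(** The exponent [a] of the weight is independent of [nu]: [FBdom] also involves the weight
    [x ^ (nu + 1/2)], and [a = - 1/2] gives the weight 1 used for measurability. *)
Lemma phi_pgw nu n a x : 0 < x ->
  phi nu n x * x `^ (2 * a + 1) = pgw a 2^-1 (phi_coef nu n *: lag nu n) x.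
Proof. by move=> x0; rewrite phiE// /pgw hornerZ. Qed.

Lemma phi_sqr_pgw nu m n a x : 0 < x -> phi nu m x * phi nu n x * x `^ (2 * a + 1) =
  pgw a 1 ((phi_coef nu m * phi_coef nu n) *: (lag nu m * lag nu n)) x.
Proof.
move=> x0; rewrite !phiE// /pgw hornerZ hornerM.
have -> : expR (- 1 * x ^+ 2) = expR (- 2^-1 * x ^+ 2) * expR (- 2^-1 * x ^+ 2).
  by rewrite -expRD; congr expR; field.
move: (phi_coef nu m) (phi_coef nu n) (expR _) (x `^ _) => c d e p.
ring.
Qed.

Lemma measurable_phi nu n : measurable_fun (Rplus R) (phi nu n).
Proof.
apply: (eq_measurable_fun (pgw (- 2^-1) 2^-1 (phi_coef nu n *: lag nu n))).
  move=> x; rewrite inE RplusE => x0; rewrite -phi_pgw//.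
  by rewrite mulrN divff ?pnatr_eq0// addNr powRr0 mulr1.
exact: measurable_pgw.
Qed.

Lemma cmeasurable_phiC nu n : cmeasurable (Rplus R) (phiC nu n).
Proof. by split; [exact: measurable_phi|exact: measurable_cst]. Qed.

Lemma Rplus_integrable_abs f : mu.-integrable (Rplus R) (EFin \o f) ->
  mu.-integrable (Rplus R) (EFin \o (fun x => `|f x|)).
Proof. by move=> hf; exact: (@integrable_abse _ _ _ mu _ _ hf). Qed.

Lemma in_wL1_phiC nu n a (D : set R) : -1 < a -> measurable D -> D `<=` Rplus R ->
  in_wL 1 D (2 * a + 1) (phiC nu n).
Proof.
move=> a1 mD DR; apply: in_wL_integrable => //; first exact: cmeasurable_phiC.
have h0 : (0 : R) < 2^-1 by rewrite invr_gt0.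
have [h _] := pgw_integral a1 (phi_coef nu n *: lag nu n) h0.
apply: Rplus_integrable_eq (Rplus_integrable_abs h) => x x0.
rewrite -phi_pgw// normc_real powRr1// normrM; congr (_ * _).
by rewrite ger0_norm// powR_ge0.
Qed.

Lemma in_L2_phiC nu n : -1 < nu -> in_L2 nu (phiC nu n).
Proof.
move=> nu1; apply: in_wL_integrable => //; first exact: cmeasurable_phiC.
have [h _] := pgw_integral nu1
  ((phi_coef nu n * phi_coef nu n) *: (lag nu n * lag nu n)) ltr01.
apply: Rplus_integrable_eq h => x x0.
rewrite -phi_sqr_pgw// normc_real; congr (_ * _).
by rewrite powR_mulrn// real_normK ?num_real// expr2.
Qed.

Lemma FBdom_phiC nu r n : -1 < nu -> 1 < r -> FBdom nu r (phiC nu n).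
Proof.
move=> nu1 r1; rewrite /FBdom; case: ifPn => _; last exact: in_wL1_phiC.
split.
  apply: in_wL1_phiC => //.
  by move=> x /=; rewrite RplusE in_itv/= => /andP[].
(* Solves [2 a + 1 = nu + 1/2]; the solution satisfies [a > -1] because [nu > -1]. *)
have -> : nu + 2^-1 = 2 * ((nu - 2^-1) / 2) + 1 by field.
apply: in_wL1_phiC; first lra.
  exact: measurable_itv.
move=> x /=; rewrite RplusE in_itv/= andbT; apply: lt_trans.
exact: lt_trans r1.
Qed.

(** [2 ^ (4 n - 1)] is [16 ^+ n / 2], and this half matches the one in [gmoment]. Positivity of
    Gamma makes the square root genuine. *)
Lemma phi_coef_sqr nu n : -1 < nu ->
  phi_coef nu n ^+ 2 * (16 ^+ n * n`!%:R * gmoment nu 1 n) = 1.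
Proof.
move=> nu1.
have n1 : 0 < n%:R + nu + 1 by rewrite -addrA addrC ltr_wpDr// -ltrBlDr sub0r.
have G0 := Gamma_gt0 n1.
have f0 : 0 < n`!%:R :> R by rewrite ltr0n fact_gt0.
have -> : phi_coef nu n ^+ 2 = (16 ^+ n / 2 * n`!%:R * Gamma (n%:R + nu + 1))^-1.
  have E : (2 : R) ^ (4 * n%:Z - 1) = 16 ^+ n / 2.
    rewrite expfzDr ?pnatr_eq0// -exprz_exp.
    by have -> : (16 : R) = 2 ^+ 4 by rewrite -natrX.
  rewrite /phi_coef expr_div_n -exprM mulnC exprM sqrrN expr1n expr1n div1r E sqr_sqrtr//.
  by rewrite !mulr_ge0 ?exprn_ge0 ?invr_ge0 ?ler0n// ltW.
rewrite /gmoment powR1 mulr1; field.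
by rewrite !gt_eqF ?exprn_gt0.
Qed.

Lemma L2dot_phiC nu m n : -1 < nu -> L2dot nu (phiC nu m) (phiC nu n) = (m == n)%:R.
Proof.
move=> nu1; rewrite /L2dot.
have -> : (fun x => phiC nu m x * (phiC nu n x)^*%C * (x `^ (2 * nu + 1))%:C) =
    (fun x => (phi nu m x * phi nu n x * x `^ (2 * nu + 1))%:C).
  by apply/funext => x; rewrite /phiC conjc_real -!rmorphM.
rewrite cintegral_real (@Rplus_Rintegral_eq _ _ (pgw nu 1
  ((phi_coef nu m * phi_coef nu n) *: (lag nu m * lag nu n)))); last first.
  exact: phi_sqr_pgw.
have [_ ->] := pgw_integral nu1
  ((phi_coef nu m * phi_coef nu n) *: (lag nu m * lag nu n)) ltr01.
rewrite momentZ moment_lag_orth; last exact: gmoment1S.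
case: eqP => [<-|_]; last by rewrite mulr0.
by rewrite -expr2 phi_coef_sqr.
Qed.

End orthonormality.

(** * The Fourier-Bessel transform *)

Section fourier_bessel.
Context {R : realType}.
Variables (nu : R) (hnu : -1 < nu).
Implicit Types (P Q : {poly R}) (u x y z : R).
Local Notation mu := (@lebesgue_measure R).

Let nu1 (k : nat) : 0 < k%:R + nu + 1.
Proof. by rewrite -addrA addrC ltr_wpDr// -ltrBlDr sub0r. Qed.

Let G0 (k : nat) : 0 < Gamma (k%:R + nu + 1).
Proof. exact: Gamma_gt0. Qed.

(** On ['X^i] the falling factorial cancels [i] factors of [k!], which shifts the exponential series
    by [i] terms. *)
Lemma cvg_moment_ffpow Q u :
  series (fun k => u ^+ k / k`!%:R * moment (ffpow k) Q) @ \oo -->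
  Q.[- 2 * u] * expR u.
Proof.
have hX i : series (fun k => u ^+ k / k`!%:R * ffpow k i) @ \oo -->
    (- 2 * u) ^+ i * expR u.
  elim: i => [|i IH].
    rewrite expr0 mul1r [X in X @ _](_ : _ = series (exp_coeff u)).
      exact: is_cvg_series_exp_coeff.
    by congr series; apply/funext => k; rewrite /ffpow ffactn0 !mulr1.
  rewrite -cvg_shiftS/= exprS -mulrA.
  rewrite [X in X @ _](_ : _ = fun N => - 2 * u *
      series (fun k => u ^+ k / k`!%:R * ffpow k i) N).
    exact: cvgMr.
  apply/funext => N; rewrite /series/= big_nat_recl//= {1}/ffpow ffact0n !mulr0 add0r.
  rewrite mulr_sumr; apply: eq_bigr => k _.
  rewrite ffpowSS factS natrM exprS; field.
  by rewrite nat1r !pnatr_eq0 -lt0n fact_gt0.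
rewrite -[Q]coefK poly_def; elim/big_ind : _ => [|A B hA hB|i _].
- rewrite horner0 mul0r [X in X @ _](_ : _ = fun=> 0); first exact: cvg_cst.
  apply/funext => N; rewrite /series/= big1// => k _.
  by rewrite linear0 mulr0.
- rewrite hornerD mulrDl [X in X @ _](_ : _ =
    (series (fun k => u ^+ k / k`!%:R * moment (ffpow k) A) +
     series (fun k => u ^+ k / k`!%:R * moment (ffpow k) B))); first exact: cvgD.
  apply/funext => N; rewrite /series/= [RHS]/GRing.add/= -big_split/=.
  by apply: eq_bigr => k _; rewrite momentD mulrDr.
rewrite hornerZ hornerXn -mulrA [X in X @ _](_ : _ = fun N => Q`_i *
  series (fun k => u ^+ k / k`!%:R * ffpow k i) N); first exact: cvgMr.
apply/funext => N; rewrite /series/= mulr_sumr; apply: eq_bigr => k _.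
by rewrite momentZ momentXn mulrCA.
Qed.

(** By [GammaS] the ratio [A ^+ k / Gamma (k + nu + 1)] is nonincreasing once [k] exceeds a bound of
    [A]. The sum of the finitely many earlier ratios then majorizes all of them. *)
Lemma exprn_le_Gamma (A : R) : 0 < A ->
  exists2 C : R, 0 < C & forall k : nat, A ^+ k <= C * Gamma (k%:R + nu + 1).
Proof.
move=> A0; pose r k := A ^+ k / Gamma (k%:R + nu + 1).
have r0 k : 0 < r k by rewrite divr_gt0 ?exprn_gt0.
pose K := Num.bound A.
have rS k : (K < k)%N -> r k.+1 <= r k.
  move=> Kk; rewrite /r.
  have -> : Gamma (k.+1%:R + nu + 1) = (k%:R + nu + 1) * Gamma (k%:R + nu + 1).
    by rewrite -(GammaS (nu1 k)); congr Gamma; rewrite -natr1; ring.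
  rewrite exprSr invfM mulrA ler_pM2r ?invr_gt0//.
  rewrite -mulrA ler_piMr ?exprn_ge0 ?(ltW A0)// ler_pdivrMr// mul1r.
  rewrite (le_trans (ltW (archi_boundP (ltW A0))))//.
  have : (K.+1)%:R <= k%:R :> R by rewrite ler_nat.
  rewrite -natr1 -/K => h; have := hnu; lra.
exists (\sum_(k < K.+2) r k).
  by rewrite big_ord_recl/= ltr_pwDl// sumr_ge0// => i _; exact: ltW.
suff H k : r k <= \sum_(k < K.+2) r k by move=> k; rewrite -ler_pdivrMr//; exact: H.
have [kK|] := ltnP k K.+2.
  rewrite (bigD1 (Ordinal kK))//= lerDl sumr_ge0// => i _; exact: ltW.
elim: k => // k IH; rewrite leq_eqVlt => /predU1P[[<-]|].
  rewrite (le_trans (rS _ _))// big_ord_recr/= lerDr sumr_ge0// => i _; exact: ltW.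
by rewrite ltnS => Kk; rewrite (le_trans (rS _ _)) ?IH// ltnW.
Qed.

(* The power series of [varphi nu]; [2 `^ (- nu)] is what is left of
   [z `^ (- nu) * (z / 2) `^ nu]. *)
Definition vterm z (k : nat) : R :=
  (-1) ^+ k / (k`!%:R * Gamma (k%:R + nu + 1)) * 2 `^ (- nu) * (z / 2) ^+ (2 * k).

(** [A] is at choice, so the partial sums of the series are bounded by a multiple of a Gaussian of
    arbitrarily slow growth. *)
Lemma vterm_bound (A : R) : 0 < A -> exists2 C : R, 0 < C &
  forall z k, `|vterm z k| <= C * exp_coeff (z ^+ 2 / (4 * A)) k.
Proof.
move=> A0; have [C C0 hC] := exprn_le_Gamma A0.
exists (C * 2 `^ (- nu)); first by rewrite mulr_gt0 ?powR_gt0.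
move=> z k; rewrite /vterm /exp_coeff/= !normrM normrX normrN1 expr1n mul1r.
rewrite normfV normrM (ger0_norm (ler0n _ _)) (gtr0_norm (G0 k)).
rewrite (ger0_norm (powR_ge0 _ _)) exprM.
have -> : `|((z / 2) ^+ 2) ^+ k| = (z ^+ 2 / 4) ^+ k.
  have -> : (z / 2) ^+ 2 = z ^+ 2 / 4 by field.
  by rewrite ger0_norm// exprn_ge0 ?divr_ge0 ?sqr_ge0.
have -> : (z ^+ 2 / (4 * A)) ^+ k = (z ^+ 2 / 4) ^+ k / A ^+ k.
  by rewrite -expr_div_n; congr (_ ^+ k); field; rewrite gt_eqF.
have f0 : 0 < k`!%:R :> R by rewrite ltr0n fact_gt0.
rewrite invfM.
have -> : C * 2 `^ (- nu) * ((z ^+ 2 / 4) ^+ k / A ^+ k / k`!%:R) =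
  k`!%:R^-1 * (C / A ^+ k) * 2 `^ (- nu) * (z ^+ 2 / 4) ^+ k by ring.
rewrite ler_wpM2r ?exprn_ge0 ?divr_ge0 ?sqr_ge0//.
rewrite ler_wpM2r ?powR_ge0// ler_wpM2l ?invr_ge0 ?(ltW f0)//.
by rewrite ler_pdivlMr ?exprn_gt0// mulrC ler_pdivrMr.
Qed.

Lemma series_exp_coeff_le u N : 0 <= u -> series (exp_coeff u) N <= expR u.
Proof.
move=> u0; apply: nondecreasing_cvgn_le; last exact: is_cvg_series_exp_coeff.
by apply: nondecreasing_series => k _ _; exact: exp_coeff_ge0.
Qed.

Lemma cvg_vterm z : 0 < z -> series (vterm z) @ \oo --> varphi nu z.
Proof.
move=> z0.
have cv : cvgn (series (vterm z)).
  have [C C0 hC] := vterm_bound ltr01.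
  apply: normed_cvg; apply: series_le_cvg (hC z) _ => //.
  - by move=> n; rewrite mulr_ge0 ?(ltW C0)// exp_coeff_ge0// divr_ge0 ?sqr_ge0.
  - rewrite (_ : (fun=> _) = C *: exp_coeff (z ^+ 2 / (4 * 1)))//.
    by apply: is_cvg_seriesZ; exact: is_cvg_series_exp_coeff.
have h : series (fun n : nat => (-1) ^+ n / (n`!%:R * Gamma (n%:R + nu + 1)) *
    (z / 2) `^ (2 * n%:R + nu)) @ \oo --> z `^ nu * limn (series (vterm z)).
  rewrite [X in X @ _](_ : _ = fun N => z `^ nu * series (vterm z) N).
    exact: cvgMr.
  apply/funext => N; rewrite /series/= mulr_sumr; apply: eq_bigr => k _.
  have z2 : 0 < z / 2 by rewrite divr_gt0.
  rewrite /vterm powRD ?(gt_eqF z2) ?implybT//.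
  rewrite -natrM powR_mulrn ?divr_ge0 ?(ltW z0)//.
  rewrite [(z / 2) `^ nu]powRM ?invr_ge0 ?(ltW z0)//.
  have -> : (2^-1 : R) `^ nu = 2 `^ (- nu).
    by rewrite -[2^-1]powR_inv1 ?ler0n// -powRrM mulN1r.
  ring.
rewrite /varphi /besselJ (cvg_lim _ h)// mulrA -powRD ?(gt_eqF z0) ?implybT//.
by rewrite addNr powRr0 mul1r.
Qed.


(** Repeated use of [GammaS] turns [Gamma (k + i + nu + 1)] into a rising factorial times
    [Gamma (k + nu + 1)]; the rate [1/2] supplies the factors 2 built into [rfpow]. *)
Lemma moment_gmoment_half (k : nat) P :
  moment (gmoment nu 2^-1) ('X^k * P) =
  2 `^ (k%:R + nu) * Gamma (k%:R + nu + 1) * moment (rfpow (k%:R + nu + 1)) P.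
Proof.
rewrite -[P]coefK poly_def mulr_sumr !linear_sum/= big_distrr/=.
apply: eq_bigr => i _.
rewrite -scalerAr !momentZ -exprD !momentXn [RHS]mulrCA; congr (_ * _).
elim: (nat_of_ord i) => [|j IH].
  rewrite addn0 /rfpow big_ord0 mulr1 /gmoment.
  have -> : (2^-1 : R) `^ (k%:R + nu + 1) = (2 `^ (k%:R + nu) * 2)^-1.
    rewrite -[2^-1]powR_inv1 ?ler0n// -powRrM mulN1r powRN.
    by rewrite [in LHS]powRD ?powRr1 ?ler0n// pnatr_eq0 implybT.
  field; rewrite gt_eqF ?powR_gt0//.
rewrite addnS rfpowS mulrCA -IH /gmoment.
have E : (k + j).+1%:R + nu + 1 = ((k + j)%:R + nu + 1) + 1 :> R.
  by rewrite -natr1; ring.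
rewrite E GammaS// powRD ?pnatr_eq0 ?invr_eq0 ?pnatr_eq0 ?implybT//.
rewrite powRr1 ?invr_ge0 ?ler0n// natrD; field.
by rewrite gt_eqF ?powR_gt0// invr_gt0.
Qed.

Lemma vterm_pgw y k P x : vterm (x * y) k * pgw nu 2^-1 P x =
  pgw nu 2^-1 (((-1) ^+ k / (k`!%:R * Gamma (k%:R + nu + 1)) * 2 `^ (- nu) *
    (y ^+ 2 / 4) ^+ k) *: ('X^k * P)) x.
Proof.
rewrite /vterm /pgw hornerZ hornerM hornerXn.
have -> : (x * y / 2) ^+ (2 * k) = (x ^+ 2) ^+ k * (y ^+ 2 / 4) ^+ k.
  by rewrite exprM -exprMn; congr (_ ^+ k); field.
ring.
Qed.

Lemma moment_vterm y k P : moment (gmoment nu 2^-1)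
    (((-1) ^+ k / (k`!%:R * Gamma (k%:R + nu + 1)) * 2 `^ (- nu) *
    (y ^+ 2 / 4) ^+ k) *: ('X^k * P)) =
  (- (y ^+ 2 / 2)) ^+ k / k`!%:R * moment (rfpow (k%:R + nu + 1)) P.
Proof.
rewrite momentZ moment_gmoment_half.
have -> : (- (y ^+ 2 / 2)) ^+ k = (-1) ^+ k * (y ^+ 2 / 4) ^+ k * 2 ^+ k.
  by rewrite -!exprMn; congr (_ ^+ k); field.
rewrite [in LHS]powRD ?pnatr_eq0 ?implybT// powR_mulrn ?ler0n// powRN.
have g0 := G0 k.
have f0 : 0 < k`!%:R :> R by rewrite ltr0n fact_gt0.
have p0 : 0 < (2 : R) `^ nu by rewrite powR_gt0.
by field; rewrite !gt_eqF.
Qed.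

Lemma varphi_pgw_integral y P : 0 < y ->
  series (fun k => (- (y ^+ 2 / 2)) ^+ k / k`!%:R * moment (rfpow (k%:R + nu + 1)) P)
    @ \oo --> \int[mu]_(x in Rplus R) (varphi nu (x * y) * pgw nu 2^-1 P x).
Proof.
move=> y0.
pose T k := ((-1) ^+ k / (k`!%:R * Gamma (k%:R + nu + 1)) * 2 `^ (- nu) *
    (y ^+ 2 / 4) ^+ k) *: ('X^k * P).
pose F N x := series (vterm (x * y)) N * pgw nu 2^-1 P x.
have FE N : F N = pgw nu 2^-1 (\sum_(0 <= k < N) T k).
  apply/funext => x; rewrite /F /series/= mulr_suml.
  rewrite {2}/pgw horner_sum !mulr_suml; apply: eq_bigr => k _.
  exact: vterm_pgw.
have h2 : (0 : R) < 2^-1 by rewrite invr_gt0.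
have IF N : \int[mu]_(x in Rplus R) F N x =
    series (fun k => (- (y ^+ 2 / 2)) ^+ k / k`!%:R * moment (rfpow (k%:R + nu + 1)) P) N.
  rewrite FE; have [_ ->] := pgw_integral hnu (\sum_(0 <= k < N) T k) h2.
  by rewrite linear_sum/=; apply: eq_bigr => k _; exact: moment_vterm.
have mF N : measurable_fun (Rplus R) (F N) by rewrite FE; exact: measurable_pgw.
have cF x : 0 < x -> F ^~ x @ \oo --> varphi nu (x * y) * pgw nu 2^-1 P x.
  by move=> x0; apply: cvgMl; apply: cvg_vterm; rewrite mulr_gt0.
(* With this [A] the partial sums at [x * y] are at most [C * exp (x ^+ 2 / 8)], which leaves the
   integrable rate [1/2 - 1/8 = 3/8]. *)
have A0 : 0 < 2 * y ^+ 2 by rewrite mulr_gt0 ?exprn_gt0.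
have [C C0 hC] := vterm_bound A0.
rewrite [X in X @ _](_ : _ = fun N => \int[mu]_(x in Rplus R) F N x); last first.
  by apply/funext => N; rewrite IF.
have b0 : (0 : R) < 3 / 8 by rewrite divr_gt0.
have [ig _] := pgw_integral hnu P b0.
apply: (@Rplus_dominated_cvg _ F _ (fun x => C * `|pgw nu (3 / 8) P x|) 0) => //.
- apply: (@measurable_fun_cvg _ _ _ _ F) => // x; rewrite RplusE; exact: cF.
- by move=> x x0 _; exact: cF.
- exact/Rplus_integrableZ/Rplus_integrable_abs.
move=> N x x0; rewrite /F normrM.
have -> : pgw nu (3 / 8) P x = expR (x ^+ 2 / 8) * pgw nu 2^-1 P x.
  have E : expR (- (3 / 8) * x ^+ 2) = expR (x ^+ 2 / 8) * expR (- 2^-1 * x ^+ 2).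
    by rewrite -expRD; congr expR; field.
  rewrite /pgw E; ring.
rewrite [X in C * X]normrM (gtr0_norm (expR_gt0 _)) [leRHS]mulrA ler_wpM2r//.
rewrite (le_trans (ler_norm_sum _ _ _))//.
rewrite (le_trans (ler_sum _ (fun k _ => hC (x * y) k)))//.
rewrite -mulr_sumr ler_wpM2l ?(ltW C0)//.
have -> : (x * y) ^+ 2 / (4 * (2 * y ^+ 2)) = x ^+ 2 / 8.
  by field; rewrite gt_eqF.
by apply: series_exp_coeff_le; rewrite divr_ge0 ?sqr_ge0.
Qed.

Lemma fourier_bessel_phiC n y : 0 < y ->
  fourier_bessel nu (phiC nu n) y = (-1) ^+ n * phiC nu n y.
Proof.
move=> y0; rewrite /fourier_bessel.
have -> : (fun x => (varphi nu (x * y))%:C * phiC nu n x * (x `^ (2 * nu + 1))%:C) =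
    (fun x => (varphi nu (x * y) * phi nu n x * x `^ (2 * nu + 1))%:C).
  by apply/funext => x; rewrite /phiC -!rmorphM.
have -> : (-1) ^+ n * phiC nu n y = ((-1) ^+ n * phi nu n y)%:C.
  by rewrite /phiC [RHS](rmorphM (real_complex R)) (rmorphXn (real_complex R))
    (rmorphN (real_complex R)) rmorph1.
rewrite cintegral_real; congr (_%:C).
rewrite (@Rplus_Rintegral_eq _ _ (fun x => varphi nu (x * y) *
  pgw nu 2^-1 (phi_coef nu n *: lag nu n) x)); last first.
  by move=> x x0; rewrite -mulrA phi_pgw.
have h1 := @varphi_pgw_integral y (phi_coef nu n *: lag nu n) y0.
(* The other expansion is [cvg_moment_ffpow] at [u = - y ^+ 2 / 2]; the two series agree term by
   term by [moment_rfpow_lag]. *)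
apply: (cvg_unique _ h1) => //.
rewrite phiE// [X in X @ _](_ : _ = fun N => (-1) ^+ n * phi_coef nu n *
    series (fun k => (- (y ^+ 2 / 2)) ^+ k / k`!%:R * moment (ffpow k) (lag nu n)) N).
  have -> : (-1) ^+ n * (phi_coef nu n * (lag nu n).[y ^+ 2] * expR (- 2^-1 * y ^+ 2)) =
      (-1) ^+ n * phi_coef nu n * ((lag nu n).[y ^+ 2] * expR (- 2^-1 * y ^+ 2)).
    by rewrite !mulrA.
  rewrite /=; apply: cvgMr.
  have := @cvg_moment_ffpow (lag nu n) (- (y ^+ 2 / 2)).
  have -> : - 2 * - (y ^+ 2 / 2) = y ^+ 2 by field.
  by have -> : - 2^-1 * y ^+ 2 = - (y ^+ 2 / 2) by field.
apply/funext => N; rewrite /series/= mulr_sumr; apply: eq_bigr => k _.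
rewrite momentZ moment_rfpow_lag; ring.
Qed.

End fourier_bessel.

(** * Density of the polynomials *)

Section density.
Import HBNNSimple.
Context {R : realType}.
Variables (nu : R) (hnu : -1 < nu).
Implicit Types (P Q : {poly R}) (u x y z a c : R) (f g h : R -> R).
Local Notation mu := (@lebesgue_measure R).

(** Multiplication by [exp (x ^+ 2 / 2)] carries [L^2(x ^ (2 nu + 1) dx)] onto [L^2(W dx)] and the
    [phi_n] to polynomials in [x ^+ 2]. *)
Let W x : R := expR (- x ^+ 2) * x `^ (2 * nu + 1).

Let W0 x : 0 <= W x.
Proof. by rewrite mulr_ge0 ?expR_ge0 ?powR_ge0. Qed.

Let WE P b x : pgw nu b P x = P.[x ^+ 2] * expR ((1 - b) * x ^+ 2) * W x.
Proof.
rewrite /pgw /W.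
have -> : expR (- b * x ^+ 2) = expR ((1 - b) * x ^+ 2) * expR (- x ^+ 2).
  by rewrite -expRD; congr expR; ring.
ring.
Qed.

Let mW : measurable_fun (Rplus R) W.
Proof.
have -> : W = pgw nu 1 1.
  by apply/funext => x; rewrite WE hornerC subrr mul0r expR0 !mul1r.
exact: measurable_pgw.
Qed.

Let L2W g := measurable_fun (Rplus R) g /\
  mu.-integrable (Rplus R) (EFin \o (fun x => g x ^+ 2 * W x)).

(** The squared norm; [nrm_add] replaces the triangle inequality, and its factors 2 account for the
    [e / 4] below. *)
Let nrm g := \int[mu]_(x in Rplus R) (g x ^+ 2 * W x).

Let m2 g : measurable_fun (Rplus R) g ->
  measurable_fun (Rplus R) (fun x => g x ^+ 2 * W x).
Proof. by move=> mg; apply: measurable_funM => //; exact: measurable_funX. Qed.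

Let L2W_dom g h : measurable_fun (Rplus R) g -> (forall x, 0 < x -> `|g x| <= h x) ->
  mu.-integrable (Rplus R) (EFin \o (fun x => h x ^+ 2 * W x)) -> L2W g.
Proof.
move=> mg gh ih; split=> //; apply: Rplus_integrable_le ih => [|x x0]; first exact: m2.
rewrite normrM normrX (ger0_norm (W0 x)) ler_wpM2r// ler_pXn2r ?nnegrE ?gh//.
exact: le_trans (gh x x0).
Qed.

Let L2W_ext g h : (forall x, 0 < x -> g x = h x) -> L2W g -> L2W h.
Proof.
move=> gh [mg ig]; split.
  by apply: eq_measurable_fun mg => x; rewrite inE RplusE; exact: gh.
by apply: Rplus_integrable_eq ig => x x0; rewrite gh.
Qed.

Let sqrD_le (p q w : R) : 0 <= w ->
  (p + q) ^+ 2 * w <= 2 * (p ^+ 2 * w) + 2 * (q ^+ 2 * w).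
Proof.
move=> w0; rewrite !mulrA -mulrDl ler_wpM2r// -subr_ge0.
by have := sqr_ge0 (p - q); congr (_ <= _); ring.
Qed.

Let L2W_add g h : L2W g -> L2W h -> L2W (fun x => g x + h x).
Proof.
move=> [mg ig] [mh ih]; have mgh := measurable_funD mg mh; split=> //.
apply: (Rplus_integrable_le _ _
  (Rplus_integrableD (Rplus_integrableZ 2 ig) (Rplus_integrableZ 2 ih))).
  exact: m2.
by move=> x x0; rewrite ger0_norm ?sqrD_le// mulr_ge0 ?sqr_ge0.
Qed.

Let nrm_add g h : L2W g -> L2W h -> nrm (fun x => g x + h x) <= 2 * nrm g + 2 * nrm h.
Proof.
move=> Lg Lh; have [mgh igh] := L2W_add Lg Lh; case: Lg Lh => [mg ig] [mh ih].
have i1 := Rplus_integrableZ 2 ig; have i2 := Rplus_integrableZ 2 ih.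
rewrite /nrm -!RintegralZl// -RintegralD//.
apply: le_Rintegral => //; first exact: Rplus_integrableD.
by move=> x _; exact: sqrD_le.
Qed.

Let L2W_scale c g : L2W g -> L2W (fun x => c * g x).
Proof.
move=> [mg ig]; split; first exact: measurable_funM.
by apply: Rplus_integrable_eq (Rplus_integrableZ (c ^+ 2) ig) => x _; ring.
Qed.

Let nrm_scale c g : L2W g -> nrm (fun x => c * g x) = c ^+ 2 * nrm g.
Proof.
move=> [mg ig]; rewrite /nrm -RintegralZl//.
by apply: eq_Rintegral => x _; ring.
Qed.

Let measurable_poly_gauss P b :
  measurable_fun (Rplus R) (fun x => P.[x ^+ 2] * expR (- b * x ^+ 2)).
Proof.
apply: (eq_measurable_fun (pgw (- 2^-1) b P)); last exact: measurable_pgw.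
move=> x; rewrite inE RplusE => x0; rewrite /pgw.
by rewrite mulrN divff ?pnatr_eq0// addNr powRr0 mulr1.
Qed.

Let L2W_poly P : L2W (fun x => P.[x ^+ 2]).
Proof.
have [i _] := pgw_integral hnu (P ^+ 2) (ltr01 : 0 < 1 :> R).
split.
  apply: eq_measurable_fun (measurable_poly_gauss P 0) => x _.
  by rewrite oppr0 mul0r expR0 mulr1.
apply: Rplus_integrable_eq i => x _.
by rewrite WE subrr mul0r expR0 mulr1 horner_exp.
Qed.

(** The closure in [L^2(W dx)] of the polynomials in [x ^+ 2]. *)
Let C g := L2W g /\
  forall eps, 0 < eps -> exists P, nrm (fun x => g x - P.[x ^+ 2]) < eps.

Let C_ext g h : (forall x, 0 < x -> g x = h x) -> C g -> C h.
Proof.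
move=> gh [Lg Cg]; split; first exact: L2W_ext Lg.
move=> e /Cg[P hP]; exists P; apply: le_lt_trans hP.
rewrite le_eqVlt; apply/orP; left; apply/eqP/Rplus_Rintegral_eq => x x0.
by rewrite gh.
Qed.

Let C_poly P : C (fun x => P.[x ^+ 2]).
Proof.
split=> // e e0; exists P; rewrite /nrm (_ : Rintegral _ _ _ = 0)//.
rewrite (@Rplus_Rintegral_eq _ _ (fun=> 0)); first by rewrite /Rintegral integral0.
by move=> x _; rewrite subrr expr0n mul0r.
Qed.

Let L2W_sub g h : L2W g -> L2W h -> L2W (fun x => g x - h x).
Proof.
move=> Lg Lh; have := L2W_add Lg (L2W_scale (-1) Lh).
by apply: L2W_ext => x _; rewrite mulN1r.
Qed.

Let C_add g h : C g -> C h -> C (fun x => g x + h x).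
Proof.
move=> [Lg Cg] [Lh Ch]; split; first exact: L2W_add.
move=> e e0; have e4 : 0 < e / 4 by rewrite divr_gt0.
have [P hP] := Cg _ e4; have [Q hQ] := Ch _ e4; exists (P + Q).
have H := nrm_add (L2W_sub Lg (L2W_poly P)) (L2W_sub Lh (L2W_poly Q)).
rewrite (_ : nrm _ = nrm (fun x => g x - P.[x ^+ 2] + (h x - Q.[x ^+ 2]))).
  apply: le_lt_trans H _; move: hP hQ; set p := nrm _; set q := nrm _; lra.
by congr Rintegral; apply/funext => x; rewrite hornerD; congr (_ ^+ 2 * _); ring.
Qed.

Let C_scale c g : C g -> C (fun x => c * g x).
Proof.
move=> [Lg Cg]; split; first exact: L2W_scale.
(* Adding 1 keeps the divisor positive when [c = 0]. *)
move=> e e0; have c0 : 0 < c ^+ 2 + 1 by rewrite ltr_wpDl ?sqr_ge0.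
have e4 : 0 < e / (c ^+ 2 + 1) by rewrite divr_gt0.
have [P hP] := Cg _ e4; exists (c *: P).
rewrite (_ : nrm _ = nrm (fun x => c * (g x - P.[x ^+ 2]))); last first.
  by congr Rintegral; apply/funext => x; rewrite hornerZ; congr (_ ^+ 2 * _); ring.
rewrite nrm_scale; last exact: L2W_sub.
have n0 : 0 <= nrm (fun x => g x - P.[x ^+ 2]).
  by apply: Rintegral_ge0 => x _; rewrite mulr_ge0 ?sqr_ge0.
move: hP; rewrite ltr_pdivlMr// mulrC => h; apply: le_lt_trans h.
by rewrite ler_wpM2r// lerDl.
Qed.

Let C_closed g : L2W g ->
  (forall eps, 0 < eps -> exists2 h, C h & nrm (fun x => g x - h x) < eps) -> C g.
Proof.
move=> Lg H; split=> // e e0; have e4 : 0 < e / 4 by rewrite divr_gt0.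
have [h [Lh Ch] hg] := H _ e4; have [P hP] := Ch _ e4; exists P.
have K := nrm_add (L2W_sub Lg Lh) (L2W_sub Lh (L2W_poly P)).
rewrite (_ : nrm _ = nrm (fun x => g x - h x + (h x - P.[x ^+ 2]))).
  apply: le_lt_trans K _; move: hP hg; set p := nrm _; set q := nrm _; lra.
by congr Rintegral; apply/funext => x; congr (_ ^+ 2 * _); ring.
Qed.

(** Dominated convergence in [L^2(W dx)]: the squared differences are at most [4 * h ^+ 2]. *)
Let C_dominated (g_ : nat -> R -> R) g h a :
  (forall n, C (g_ n)) -> measurable_fun (Rplus R) g ->
  (forall n x, 0 < x -> `|g_ n x| <= h x) -> (forall x, 0 < x -> `|g x| <= h x) ->
  mu.-integrable (Rplus R) (EFin \o (fun x => h x ^+ 2 * W x)) ->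
  (forall x, 0 < x -> x != a -> g_ ^~ x @ \oo --> g x) -> C g.
Proof.
move=> Cg mg ghn gh ih cg; have Lg := L2W_dom mg gh ih.
apply: C_closed => // e e0.
have : nrm (fun x => g x - g_ n x) @[n --> \oo] --> (0 : R).
  rewrite -[X in _ --> X](_ : \int[mu]_(x in Rplus R) 0 = 0); last first.
    by rewrite /Rintegral integral0.
  apply: (Rplus_dominated_cvg (g := fun x => 4 * (h x ^+ 2 * W x)) (a := a)).
  - by move=> n; apply: m2; apply: measurable_funB => //; have [[]] := Cg n.
  - exact: measurable_cst.
  - move=> x x0 xa; rewrite -[X in _ --> X](mul0r (W x)); apply: cvgMl.
    rewrite -[X in _ --> X](expr0n R 2).
    have hc : {for (0 : R), continuous (fun t : R => t ^+ 2)}.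
      exact: exprn_continuous.
    apply: (continuous_cvg _ hc).
    by rewrite -(subrr (g x)); apply: cvgB; [exact: cvg_cst|exact: cg].
  - exact: Rplus_integrableZ.
  move=> n x x0; rewrite ger0_norm ?(mulr_ge0 (sqr_ge0 _) (W0 _))// mulrA ler_wpM2r//.
  have -> : 4 * h x ^+ 2 = (2 * h x) ^+ 2 by ring.
  rewrite -real_normK ?num_real// ler_pXn2r ?nnegrE//.
    by rewrite (le_trans (ler_normB _ _))// mulr2n mulrDl mul1r lerD ?gh ?ghn.
  by rewrite mulr_ge0// (le_trans _ (gh x x0)).
move=> /cvgrPdist_lt /(_ e e0)[N _ /(_ N (leqnn N))] H.
exists (g_ N) => //; move: H; rewrite sub0r normrN; apply: le_lt_trans.
exact: ler_norm.
Qed.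

Let C_sum I (s : seq I) (F : I -> R -> R) : (forall i, C (F i)) ->
  C (fun x => \sum_(i <- s) F i x).
Proof.
move=> CF; elim: s => [|i s IH].
  by apply: C_ext (C_poly 0) => x _; rewrite big_nil horner0.
by apply: C_ext (C_add (CF i) IH) => x _; rewrite big_cons.
Qed.

(** * Exponentials in the closure *)

Let expRN_le1 c x : 0 <= c -> expR (- c * x ^+ 2) <= 1.
Proof. by move=> c0; rewrite expR_le1 mulNr oppr_le0 mulr_ge0 ?sqr_ge0. Qed.

(** Each step of the induction expands only one new factor [exp (- s t)], so the majorant
    [|P| * exp (t / 4)] serves for every [i]. Its square against [W] still has the Gaussian rate
    [1/2]. *)
Let C_poly_exp P s (i : nat) : 0 <= s -> s <= 4^-1 ->
  C (fun x => P.[x ^+ 2] * expR (- (i%:R * s) * x ^+ 2)).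
Proof.
move=> s0 s4; elim: i P => [|i IH] P.
  by apply: C_ext (C_poly P) => x _; rewrite mul0r oppr0 mul0r expR0 mulr1.
pose S N := \sum_(0 <= k < N) ((- s) ^+ k / k`!%:R) *: 'X^k.
pose B x := P.[x ^+ 2] * expR (- (i%:R * s) * x ^+ 2).
have SE N x : (S N).[x ^+ 2] = series (exp_coeff (- (s * x ^+ 2))) N.
  rewrite /S horner_sum; apply: eq_bigr => k _.
  by rewrite hornerZ hornerXn /exp_coeff/= -mulNr [in RHS]exprMn [RHS]mulrAC.
have h2 : (0 : R) < 2^-1 by rewrite invr_gt0.
have [ih _] := pgw_integral hnu (P ^+ 2) h2.
have B0 x : `|B x| <= `|P.[x ^+ 2]|.
  rewrite normrM (ger0_norm (expR_ge0 _)) ler_piMr// expRN_le1//.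
  by rewrite mulr_ge0.
have ex1 x : 1 <= expR (4^-1 * x ^+ 2).
  by rewrite -expR0 ler_expR mulr_ge0 ?sqr_ge0 ?invr_ge0.
apply: (@C_dominated (fun N x => (S N * P).[x ^+ 2] * expR (- (i%:R * s) * x ^+ 2))
  _ (fun x => `|P.[x ^+ 2]| * expR (4^-1 * x ^+ 2)) 0) => //.
- move=> N x x0; rewrite hornerM -mulrA normrM SE mulrC -/(B x).
  rewrite ler_pM// ?B0// (le_trans (ler_norm_sum _ _ _))//.
  rewrite (le_trans _ (_ : expR (s * x ^+ 2) <= _))//; last first.
    by rewrite ler_expR ler_wpM2r ?sqr_ge0.
  have w0 : 0 <= s * x ^+ 2 by rewrite mulr_ge0 ?sqr_ge0.
  rewrite (le_trans _ (series_exp_coeff_le N w0))//.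
  rewrite le_eqVlt; apply/orP; left; apply/eqP/eq_bigr => k _.
  by rewrite /exp_coeff/= normrM normrX normrN (ger0_norm w0) ger0_norm// invr_ge0.
- move=> x x0; rewrite normrM ler_pM// (ger0_norm (expR_ge0 _)).
  by rewrite (le_trans _ (ex1 x))// expRN_le1// mulr_ge0.
- apply: Rplus_integrable_eq ih => x _; rewrite WE; congr (_ * _).
  rewrite horner_exp exprMn real_normK ?num_real//; congr (_ * _).
  by rewrite -expRM_natl; congr expR; field.
move=> x x0 _.
have -> : P.[x ^+ 2] * expR (- (i.+1%:R * s) * x ^+ 2) = expR (- (s * x ^+ 2)) * B x.
  rewrite /B; have -> : expR (- (i.+1%:R * s) * x ^+ 2) =
      expR (- (s * x ^+ 2)) * expR (- (i%:R * s) * x ^+ 2).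
    by rewrite -expRD -natr1; congr expR; ring.
  ring.
rewrite [X in X @ _](_ : _ = fun N => series (exp_coeff (- (s * x ^+ 2))) N * B x).
  by apply: cvgMl; exact: is_cvg_series_exp_coeff.
by apply/funext => N; rewrite -SE hornerM /B -[LHS]mulrA.
Qed.

Let C_exp s : 0 <= s -> C (fun x => expR (- s * x ^+ 2)).
Proof.
move=> s0.
(* An arbitrary rate [s] is reached in [m] equal steps of size at most [1/4]. *)
have [m m0 s1] : exists2 m : nat, 0 < m%:R :> R & s / m%:R <= 4^-1.
  exists (Num.bound (4 * s)).+1; first by rewrite ltr0n.
  rewrite ler_pdivrMr ?ltr0n// ler_pdivlMl// ltW//.
  by rewrite (lt_le_trans (archi_boundP _)) ?mulr_ge0// ler_nat.
have ms : m%:R * (s / m%:R) = s by rewrite mulrCA divff ?mulr1// gt_eqF.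
have := @C_poly_exp 1 (s / m%:R) m (divr_ge0 s0 (ltW m0)) s1.
by apply: C_ext => x _; rewrite ms hornerC mul1r.
Qed.

Let C_horner_exp Q s : 0 <= s -> C (fun x => Q.[expR (- s * x ^+ 2)]).
Proof.
move=> s0; apply: (@C_ext (fun x => \sum_(i <- iota 0 (size Q))
    Q`_i * expR (- (i%:R * s) * x ^+ 2))).
  move=> x _; rewrite horner_coef -(big_mkord xpredT (fun i => Q`_i * _ ^+ i)).
  rewrite /index_iota subn0; apply: eq_bigr => i _; congr (_ * _).
  by rewrite -expRM_natl; congr expR; ring.
by apply: C_sum => i; apply: C_scale; apply: C_exp; rewrite mulr_ge0.
Qed.

(* Polynomials bounded by 1 on [0, 1], tending to 1 on ]1/2, 1] and to 0 on
   [0, 1/2[. *)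
Let step n : {poly R} := 1 - (1 - 'X^n) ^+ (2 ^ n).

Let stepE n u : (step n).[u] = 1 - (1 - u ^+ n) ^+ (2 ^ n).
Proof. by rewrite /step !(hornerD, hornerN, horner_exp, hornerX, hornerC). Qed.

Let step_01 n u : 0 <= u <= 1 -> 0 <= (step n).[u] <= 1.
Proof.
move=> /andP[u0 u1]; rewrite stepE subr_ge0 lerBlDr lerDl.
have h1 : 0 <= 1 - u ^+ n by rewrite subr_ge0 exprn_ile1.
by rewrite exprn_ge0// exprn_ile1// lerBlDr lerDl exprn_ge0.
Qed.

Let bernoulli_ineq (v : R) M : 0 <= v <= 1 -> 1 - M%:R * v <= (1 - v) ^+ M.
Proof.
move=> /andP[v0 v1]; elim: M => [|M IH]; first by rewrite mul0r subr0 expr0.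
rewrite exprSr -natr1; apply: le_trans (ler_wpM2r _ IH); last by rewrite subr_ge0.
rewrite -subr_ge0; have -> : (1 - M%:R * v) * (1 - v) - (1 - (M%:R + 1) * v) =
  M%:R * v ^+ 2 by ring.
by rewrite mulr_ge0 ?sqr_ge0.
Qed.

(** Bernoulli's inequality bounds the value by [(2 * u) ^+ n]. *)
Let step_cvg0 u : 0 <= u -> u < 2^-1 -> (step n).[u] @[n --> \oo] --> (0 : R).
Proof.
move=> u0 u2; have u1 : u <= 1 by lra.
apply: (@squeeze_cvgr _ _ _ _ (fun=> 0) (fun n => (2 * u) ^+ n)).
- apply: nearW => n; have /andP[-> _]/= := @step_01 n u (introT andP (conj u0 u1)).
  rewrite stepE lerBlDr -lerBlDl (le_trans _ (bernoulli_ineq _ _))//.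
    by rewrite natrX exprMn.
  by rewrite exprn_ge0// exprn_ile1.
- exact: cvg_cst.
- by apply: cvg_expr; rewrite ger0_norm ?mulr_ge0//; lra.
Qed.

(** [(1 - u ^+ n) ^+ (2 ^ n)] is at most [exp (- (2 * u) ^+ n)], hence at most [(2 * u) ^- n]. *)
Let step_cvg1 u : 2^-1 < u -> u <= 1 -> (step n).[u] @[n --> \oo] --> (1 : R).
Proof.
move=> u2 u1; have u0 : 0 < u by lra.
rewrite -[X in _ --> X](subr0 1) [X in X @ _](_ : _ =
  fun n : nat => 1 - (1 - u ^+ n) ^+ (2 ^ n)); last by apply/funext => n; exact: stepE.
apply: cvgB; first exact: cvg_cst.
apply: (@squeeze_cvgr _ _ _ _ (fun=> 0) (fun n => ((2 * u)^-1) ^+ n)).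
- apply: nearW => n.
  have h1 : 0 <= 1 - u ^+ n by rewrite subr_ge0 exprn_ile1// ltW.
  rewrite exprn_ge0//=.
  have h2 : 1 - u ^+ n <= expR (- u ^+ n) by exact: expR_ge1Dx.
  have h3 : (1 - u ^+ n) ^+ (2 ^ n) <= expR (- u ^+ n) ^+ (2 ^ n).
    by rewrite lerXn2r// nnegrE expR_ge0.
  rewrite (le_trans h3)// -expRM_natl mulrN natrX -exprMn expRN exprVn.
  have p0 : 0 < (2 * u) ^+ n by rewrite exprn_gt0 ?mulr_gt0.
  rewrite lef_pV2 ?posrE ?expR_gt0//.
  by rewrite (le_trans _ (expR_ge1Dx _))// lerDr.
- exact: cvg_cst.
- apply: cvg_expr; rewrite ger0_norm ?invr_ge0 ?mulr_ge0 ?(ltW u0)//.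
  by rewrite invf_lt1 ?mulr_gt0//; lra.
Qed.

(** * From rays to all of L2 *)

Let C_ray a : C (\1_`]-oo, a[%classic : R -> R).
Proof.
have [a0|a0] := leP a 0.
  apply: C_ext (C_poly 0) => x x0; rewrite horner0 indicE memNset//= in_itv/=.
  by apply/negP; rewrite -leNgt (le_trans a0)// ltW.
(* Chosen so that the decreasing function [u] below takes the value [1/2] at [a]; this [a] is the
   exceptional point of [C_dominated]. *)
pose s := ln 2 / a ^+ 2.
have ln20 : 0 < ln (2 : R) by rewrite ln_gt0// ltr1n.
have s0 : 0 < s by rewrite divr_gt0 ?exprn_gt0.
have e2 : expR (- s * a ^+ 2) = 2^-1.
  by rewrite mulNr divfK ?gt_eqF ?exprn_gt0// expRN lnK ?posrE.
pose u x := expR (- s * x ^+ 2).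
have u01 x : 0 <= u x <= 1.
  by rewrite expR_ge0 expRN_le1// ltW.
have [i1 _] := pgw_integral hnu 1 (ltr01 : 0 < 1 :> R).
apply: (@C_dominated (fun n x => (step n).[u x]) _ (fun=> 1) a) => //.
- by move=> n; apply: C_horner_exp; exact: ltW.
- by move=> n x _; have /andP[h1 h2] := step_01 n (u01 x); rewrite ger0_norm.
- by move=> x _; rewrite indicE; case: (_ \in _); rewrite ?normr1 ?normr0.
- apply: Rplus_integrable_eq i1 => x _.
  by rewrite WE hornerC subrr mul0r expR0 expr1n !mul1r.
have u_lt x y : 0 < x -> x < y -> u y < u x.
  move=> x0 xy; rewrite ltr_expR !mulNr ltrN2 ltr_pM2l// ltrXn2r// ?ltW//.
move=> x x0 xa; rewrite indicE mem_setE in_itv/=.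
case: ltP xa => [xa _|+ xa]; last rewrite le_eqVlt eq_sym (negbTE xa)/= => ax.
  apply: step_cvg1; last by case/andP: (u01 x).
  by rewrite -e2; exact: u_lt.
apply: step_cvg0; first by case/andP: (u01 x).
by rewrite -e2; exact: u_lt.
Qed.

Let C_indic (A : set R) : measurable A -> C (\1_A : R -> R).
Proof.
have indE B x : (\1_B : R -> R) x = (x \in B)%:R by rewrite indicE.
have C1 : C (fun=> 1) by apply: C_ext (C_poly 1) => x _; rewrite hornerC.
have [i1 _] := pgw_integral hnu 1 (ltr01 : 0 < 1 :> R).
have iW : mu.-integrable (Rplus R) (EFin \o (fun x => 1 ^+ 2 * W x)).
  apply: Rplus_integrable_eq i1 => x _.
  by rewrite WE hornerC subrr mul0r expR0 expr1n !mul1r.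
move=> mA; have {mA} : <<s @RGenInftyO.G R >> A.
  by have : (@ocitv R).-sigma.-measurable A := mA; rewrite RGenInftyO.measurableE.
move: A; apply: (@dynkin_induction _ (measurableTypeR R) (@RGenInftyO.G R)
  (fun B => C (\1_B : R -> R))).
- exact: RGenInftyO.measurableE.
- move=> _ _ [x ->] [y ->]; exists (Num.min x y).
  by apply/seteqP; split=> z /=; rewrite !in_itv/= lt_min => /andP.
- by apply: C_ext C1 => x _; rewrite indE in_setT.
- by move=> _ [x ->]; exact: C_ray.
- move=> S mS CS; apply: C_ext (C_add C1 (C_scale (-1) CS)) => x _.
  rewrite !indE in_setC; case: (x \in S); rewrite ?mulr1 ?mulr0 ?addr0 ?subrr//.
- move=> F mF tF CF.
  pose S n x := \sum_(0 <= k < n) (\1_(F k) : R -> R) x.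
  (* By disjointness at most one set contains [x]; the partial sums jump from 0 to 1 just after its
     index [k0], or stay 0. *)
  have SE x : (exists2 k0 : nat, (\bigcup_k F k) x & forall n, S n x = (k0 < n)%:R) \/
      (~ (\bigcup_k F k) x /\ forall n, S n x = 0).
    have [[k0 _ Fk0]|nF] := pselect ((\bigcup_k F k) x); [left|right].
      exists k0; first by exists k0.
      move=> n; rewrite /S (eq_bigr (fun k => if k == k0 then 1 else 0)).
        rewrite -big_mkcond big_nat1_eq; by case: ltnP.
      move=> k _; rewrite indE; case: eqP => [->|kk0]; first by rewrite mem_set.
      rewrite memNset// => Fk; apply: kk0; apply: (tF k k0) => //.
      by exists x.
    split=> // n; rewrite /S big1// => k _; rewrite indE memNset// => Fk.
    by apply: nF; exists k.
  apply: (@C_dominated S _ (fun=> 1) 0) => //.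
  + by move=> n; exact: C_sum.
  + by apply: measurable_indic; exact: bigcupT_measurable.
  + move=> n x _; have [[k0 _ ->]|[_ ->]] := SE x; last by rewrite normr0.
    by case: (_ < _)%N; rewrite ?normr1 ?normr0.
  + by move=> x _; rewrite indE; case: (_ \in _); rewrite ?normr1 ?normr0.
  move=> x x0 _; rewrite indE; have [[k0 Ux Sx]|[Ux Sx]] := SE x.
    rewrite mem_set//; apply: cvg_near_cst; exists k0.+1 => // n /= kn.
    by rewrite Sx kn.
  by rewrite memNset//; apply: cvg_near_cst; apply: nearW => n; rewrite Sx.
Qed.

Let C_ge0 f : L2W f -> (forall x, 0 < x -> 0 <= f x) -> C f.
Proof.
move=> [mf fi] f0; have mfe : measurable_fun (Rplus R) (EFin \o f).
  exact/measurable_EFinP.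
pose f_ := nnsfun_approx (measurable_Rplus R) mfe.
have f0e x : Rplus R x -> (0 <= (f x)%:E)%E by rewrite RplusE lee_fin; exact: f0.
have cf x : 0 < x -> (fun n => f_ n x) @ \oo --> f x.
  move=> x0; have Rx : Rplus R x by rewrite RplusE.
  by have /fine_cvgP[_] := cvg_nnsfun_approx (measurable_Rplus R) mfe f0e Rx.
have fn0 n x : 0 <= f_ n x by exact: fun_ge0.
have fle n x : 0 < x -> f_ n x <= f x.
  move=> x0; rewrite -(cvg_lim _ (cf x x0))//; apply: nondecreasing_cvgn_le.
    by move=> i j ij; exact/lefP/nd_nnsfun_approx.
  by apply/cvg_ex; exists (f x); exact: cf.
apply: (@C_dominated (fun n x => f_ n x) _ f 0) => //.
- move=> n.
  pose S x := \sum_(y <- finmap.enum_fset (fset_set (range (f_ n))))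
    y * (\1_(f_ n @^-1` [set y]) : R -> R) x.
  have CS : C S.
    apply: C_sum => y; apply: C_scale; apply: C_indic.
    exact: measurable_sfunP.
  refine (@C_ext S (f_ n) _ CS) => x _.
  by rewrite /S [RHS](fimfunE (f_ n)) fsbig_finite.
- by move=> n x x0; rewrite ger0_norm// fle.
- by move=> x x0; rewrite ger0_norm// f0.
- by move=> x x0 _; exact: cf.
Qed.

Let C_L2W f : L2W f -> C f.
Proof.
move=> Lf; have [mf fi] := Lf.
have mp : measurable_fun (Rplus R) (fun x => Num.max (f x) 0).
  by apply: measurable_maxr => //; exact: measurable_cst.
have mn : measurable_fun (Rplus R) (fun x => Num.max (- f x) 0).
  by apply: measurable_maxr; [exact: measurableT_comp|exact: measurable_cst].
have fi' : mu.-integrable (Rplus R) (EFin \o (fun x => `|f x| ^+ 2 * W x)).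
  by apply: Rplus_integrable_eq fi => x _; rewrite real_normK ?num_real.
have Cp : C (fun x => Num.max (f x) 0).
  apply: C_ge0 => [|x _]; last by rewrite le_max lexx orbT.
  apply: L2W_dom mp _ fi' => x _; by case: (leP (f x) 0) => h; rewrite ?normr0.
have Cn : C (fun x => Num.max (- f x) 0).
  apply: C_ge0 => [|x _]; last by rewrite le_max lexx orbT.
  apply: L2W_dom mn _ fi' => x _; by case: (leP (- f x) 0) => h; rewrite ?normr0 ?normrN.
apply: C_ext (C_add Cp (C_scale (-1) Cn)) => x _; rewrite mulN1r.
by case: (leP (f x) 0); case: (leP (- f x) 0); lra.
Qed.

Lemma poly_dense f : measurable_fun (Rplus R) f ->
  mu.-integrable (Rplus R)
    (EFin \o (fun x => f x ^+ 2 * (expR (- x ^+ 2) * x `^ (2 * nu + 1)))) ->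
  forall eps, 0 < eps -> exists2 P,
  mu.-integrable (Rplus R) (EFin \o (fun x =>
    (f x - P.[x ^+ 2]) ^+ 2 * (expR (- x ^+ 2) * x `^ (2 * nu + 1)))) &
  \int[mu]_(x in Rplus R)
    ((f x - P.[x ^+ 2]) ^+ 2 * (expR (- x ^+ 2) * x `^ (2 * nu + 1))) < eps.
Proof.
move=> mf fi eps e0; have Lf : L2W f by [].
have [_ /(_ _ e0)[P hP]] := C_L2W Lf.
by exists P => //; have [] := L2W_sub Lf (L2W_poly P).
Qed.

End density.

(** * Completeness *)

Section completeness.
Context {R : realType}.
Variables (nu : R) (hnu : -1 < nu).
Local Notation mu := (@lebesgue_measure R).

Lemma sqr_normc (z : R[i]) :
  ComplexField.Normc.normc z `^ 2 = complex.Re z ^+ 2 + complex.Im z ^+ 2.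
Proof.
case: z => a b /=; rewrite powR_mulrn ?sqrtr_ge0// sqr_sqrtr//.
by rewrite addr_ge0 ?sqr_ge0.
Qed.

Lemma phi_coef_neq0 n : phi_coef nu n != 0.
Proof.
apply/negP => /eqP c0; have := phi_coef_sqr n hnu.
by rewrite c0 expr0n mul0r => /esym/eqP; rewrite oner_eq0.
Qed.

(** The coefficients are extended by 0, so that one [N] can serve both the real and the imaginary
    part later. *)
Lemma phi_span (P : {poly R}) : exists c : nat -> R, forall N x, (size P <= N)%N ->
  0 < x -> P.[x ^+ 2] * expR (- 2^-1 * x ^+ 2) = \sum_(k < N) c k * phi nu k x.
Proof.
have [c cE] := lag_span nu P.
exists (fun k => if (k < size P)%N then c k / phi_coef nu k else 0) => N x PN x0.
rewrite {1}cE horner_sum mulr_suml.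
rewrite (big_ord_widen _
  (fun k => (c k *: lag nu k).[x ^+ 2] * expR (- 2^-1 * x ^+ 2)) PN).
rewrite big_mkcond; apply: eq_bigr => k _; case: ifP => _; last by rewrite mul0r.
rewrite phiE// hornerZ; field; exact: phi_coef_neq0.
Qed.

Lemma ReIm_sum_phiC (c d : nat -> R) N x :
  \sum_(k < N) (c k +i* d k)%C * phiC nu k x =
  (\sum_(k < N) c k * phi nu k x) +i* (\sum_(k < N) d k * phi nu k x).
Proof.
elim: N => [|N IH]; first by rewrite !big_ord0.
rewrite !big_ord_recr/= IH; apply/eqP; rewrite eq_complex/=.
by rewrite !mulr0 subr0 add0r !eqxx.
Qed.

Lemma Rplus_wLnorm_lt (f : R -> R[i]) (g h : R -> R) a eps : 0 < eps ->
  (forall x, 0 < x ->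
    ComplexField.Normc.normc (f x) `^ 2 * x `^ a = g x + h x) ->
  mu.-integrable (Rplus R) (EFin \o g) -> mu.-integrable (Rplus R) (EFin \o h) ->
  (forall x, 0 < x -> 0 <= g x + h x) ->
  \int[mu]_(x in Rplus R) g x + \int[mu]_(x in Rplus R) h x < eps ^+ 2 ->
  (wLnorm 2 (Rplus R) a f < eps%:E)%E.
Proof.
move=> e0 fgh ig ih gh0 lt; rewrite /wLnorm.
have igh := Rplus_integrableD ig ih.
have -> : (\int[mu]_(x in Rplus R) (ComplexField.Normc.normc (f x) `^ 2 * x `^ a)%:E =
    (\int[mu]_(x in Rplus R) (g x + h x))%:E)%E.
  rewrite /Rintegral fineK; last exact: (@integrable_fin_num _ _ _ mu _ _ _ igh).
  by apply: eq_integral => x; rewrite inE RplusE => x0; rewrite fgh.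
rewrite poweR_EFin lte_fin powR12_sqrt; last first.
  by apply: Rintegral_ge0 => x; rewrite RplusE; exact: gh0.
rewrite -[eps]ger0_norm ?(ltW e0)// -sqrtr_sqr ltr_sqrt ?exprn_gt0//.
by rewrite RintegralD.
Qed.

(** Real and imaginary parts are multiplied by [exp (x ^+ 2 / 2)] and approximated separately by
    [poly_dense], each with squared error below [eps ^+ 2 / 2]. *)
Lemma phiC_dense (f : R -> R[i]) : in_L2 nu f -> forall eps : R, 0 < eps ->
  exists (N : nat) (c : nat -> R[i]),
    (L2norm nu (fun x => f x - \sum_(k < N) c k * phiC nu k x)%R < eps%:E)%E.
Proof.
move=> [[mr mi]]; rewrite /wLnorm => /lty_poweRy.
rewrite invr_eq0 pnatr_eq0 => /(_ isT) If.
move=> eps e0.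
have expK x : expR (2^-1 * x ^+ 2) ^+ 2 * expR (- x ^+ 2) = 1 :> R.
  by rewrite -expRM_natl mulrA divff ?pnatr_eq0// mul1r -expRD subrr expR0.
have mE : measurable_fun (Rplus R) (fun x : R => expR (2^-1 * x ^+ 2)).
  apply: Rplus_continuous_measurable => x x0.
  apply: (@continuous_comp _ _ _ (fun t : R => 2^-1 * t ^+ 2) expR).
    apply: (@continuous_comp _ _ _ (fun t : R => t ^+ 2)).
      exact: exprn_continuous.
    exact: mulrl_continuous.
  exact: continuous_expR.
have mN : measurable_fun (Rplus R)
    (fun x => ComplexField.Normc.normc (f x) `^ 2 * x `^ (2 * nu + 1)).
  apply: measurable_funM; last first.
    by apply: Rplus_continuous_measurable => x; exact: powR_continuous.
  under eq_fun do rewrite sqr_normc.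
  by apply: measurable_funD; exact: measurable_funX.
have iN : mu.-integrable (Rplus R) (EFin \o
    (fun x => ComplexField.Normc.normc (f x) `^ 2 * x `^ (2 * nu + 1))).
  apply/integrableP; split; first exact/measurable_EFinP.
  under eq_integral => x _ do rewrite /= ger0_norm ?mulr_ge0 ?powR_ge0//.
  exact: If.
(* [p] stands for the real or the imaginary part; its square is dominated by the squared modulus. *)
have dense (p : R[i] -> R) : measurable_fun (Rplus R) (fun x => p (f x)) ->
    (forall z, p z ^+ 2 <= ComplexField.Normc.normc z `^ 2) ->
    exists2 P : {poly R},
    mu.-integrable (Rplus R) (EFin \o (fun x =>
      (p (f x) - P.[x ^+ 2] * expR (- 2^-1 * x ^+ 2)) ^+ 2 * x `^ (2 * nu + 1))) &
    \int[mu]_(x in Rplus R)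
      ((p (f x) - P.[x ^+ 2] * expR (- 2^-1 * x ^+ 2)) ^+ 2 * x `^ (2 * nu + 1))
      < eps ^+ 2 / 2.
  move=> mp pz; pose g x := p (f x) * expR (2^-1 * x ^+ 2).
  have mg : measurable_fun (Rplus R) g by exact: measurable_funM.
  have gE (x : R) : g x ^+ 2 * (expR (- x ^+ 2) * x `^ (2 * nu + 1)) =
      p (f x) ^+ 2 * x `^ (2 * nu + 1).
    transitivity (p (f x) ^+ 2 * x `^ (2 * nu + 1) *
      (expR (2^-1 * x ^+ 2) ^+ 2 * expR (- x ^+ 2))); first by rewrite /g; ring.
    by rewrite expK mulr1.
  have ig : mu.-integrable (Rplus R)
      (EFin \o (fun x => g x ^+ 2 * (expR (- x ^+ 2) * x `^ (2 * nu + 1)))).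
    apply: Rplus_integrable_le iN => [|x x0].
      apply: measurable_funM; first exact: measurable_funX.
      apply: measurable_funM.
        apply: Rplus_continuous_measurable => x x0; exact: continuous_gauss_fun.
      by apply: Rplus_continuous_measurable => x; exact: powR_continuous.
    by rewrite gE ger0_norm ?ler_wpM2r ?powR_ge0// mulr_ge0 ?sqr_ge0 ?powR_ge0.
  have e2 : 0 < eps ^+ 2 / 2 by rewrite divr_gt0 ?exprn_gt0.
  have [P iP hP] := poly_dense hnu mg ig e2.
  have E (x : R) : (g x - P.[x ^+ 2]) ^+ 2 * (expR (- x ^+ 2) * x `^ (2 * nu + 1)) =
      (p (f x) - P.[x ^+ 2] * expR (- 2^-1 * x ^+ 2)) ^+ 2 * x `^ (2 * nu + 1).
    have -> : p (f x) - P.[x ^+ 2] * expR (- 2^-1 * x ^+ 2) =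
        (g x - P.[x ^+ 2]) * expR (- 2^-1 * x ^+ 2).
      by rewrite mulrBl /g -mulrA -expRD mulNr addrN expR0 mulr1.
    have -> : expR (- x ^+ 2) = expR (- 2^-1 * x ^+ 2) ^+ 2.
      by rewrite -expRM_natl; congr expR; field.
    ring.
  exists P; first by apply: Rplus_integrable_eq iP => x _; exact: E.
  apply: le_lt_trans hP.
  by rewrite le_eqVlt (@Rplus_Rintegral_eq _ _ _ (fun x _ => E x)) eqxx.
have le_re (z : R[i]) : complex.Re z ^+ 2 <= ComplexField.Normc.normc z `^ 2.
  by rewrite sqr_normc lerDl sqr_ge0.
have le_im (z : R[i]) : complex.Im z ^+ 2 <= ComplexField.Normc.normc z `^ 2.
  by rewrite sqr_normc lerDr sqr_ge0.
have [P iP hP] := dense _ mr le_re; have [Q iQ hQ] := dense _ mi le_im.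
have [c cE] := phi_span P; have [d dE] := phi_span Q.
pose N := maxn (size P) (size Q).
exists N, (fun k => (c k +i* d k)%C).
apply: Rplus_wLnorm_lt e0 _ iP iQ _ _.
- move=> x x0; rewrite ReIm_sum_phiC sqr_normc mulrDl.
  rewrite (cE N) ?leq_maxl// (dE N) ?leq_maxr//.
  by case: (f x).
- by move=> x x0; rewrite addr_ge0// mulr_ge0 ?sqr_ge0 ?powR_ge0.
- by move: hP hQ; lra.
Qed.

Lemma orthonormal_basis_phiC : orthonormal_basis nu (phiC nu).
Proof.
split; first by move=> n; exact: in_L2_phiC.
- by move=> m n; exact: L2dot_phiC.
- exact: phiC_dense.
Qed.

End completeness.

Theorem theorem6p5 (R : realType) (nu r : R) (hnu : -1 < nu) (hr : 1 < r) :
  [/\ forall n : nat, FBdom nu r (phiC nu n) /\ in_L2 nu (phiC nu n),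
      orthonormal_basis nu (phiC nu)
    & forall (n : nat) (y : R), 0 < y ->
        fourier_bessel nu (phiC nu n) y = (-1) ^+ n * phiC nu n y].
Proof.
split.
- by move=> n; split; [exact: FBdom_phiC|exact: in_L2_phiC].
- exact: orthonormal_basis_phiC.
- by move=> n y; exact: fourier_bessel_phiC.
Qed.
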